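(* Let $V$ be a DVR with quotient field $K$ and perfect residue field. Then the set $\mathbb{K}^{\mathrm{br}}$ is equal to the algebraic closure of $\mathbb{K}^{\mathrm{ur}}$ in $\mathbb{K}$. More precisely, for any $\alpha\in\mathbb{K}^{\mathrm{br}}$, the extension $\mathbb{K}^{\mathrm{ur}}\subseteq\mathbb{K}^{\mathrm{ur}}(\alpha)$ is totally ramified. In particular, $\mathbb{K}^{\mathrm{br}}$ is a field.
   Context: A DVR is a discrete valuation domain of rank one (value group isomorphic to $\mathbb{Z}$). $V$ is a DVR with quotient field $K$, associated valuation $v$ and value group $\Gamma_v$. $\widehat K$ is the $v$-adic completion of $K$, $\overline{\widehat K}$ an algebraic closure of $\widehat K$, and $v$ also denotes its unique extension to $\overline{\widehat K}$; $\mathbb{K}$ is the completion of $\overline{\widehat K}$ with respect to $v$, with the extended valuation again denoted $v$. For $s\in\mathbb{K}$, $e_s=e(\widehat K(s)\mid\widehat K)$ is the ramification index, i.e. the index of $v(\widehat K^\times)=\Gamma_v$ in $v(\widehat K(s)^\times)$, an element of $\mathbb{N}\cup\{\infty\}$; put $\mathbb{K}^{\mathrm{br}}=\{\alpha\in\mathbb{K}\mid e_\alpha<\infty\}$. $\widehat K^{\mathrm{ur}}$ is the maximal unramified extension of $\widehat K$ in $\overline{\widehat K}$ (the compositum of all finite unramified extensions of $\widehat K$ in $\overline{\widehat K}$, where unramified means ramification index $1$ and separable residue field extension), and $\mathbb{K}^{\mathrm{ur}}$ is its completion, viewed as a subfield of $\mathbb{K}$ (the closure of $\widehat K^{\mathrm{ur}}$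 in $\mathbb{K}$). A totally ramified extension is a finite extension of valued fields with trivial residue field extension. *)

(* Defs.v *)
From HB Require Import structures.
From mathcomp Require Import all_boot all_order all_algebra finmap.
From mathcomp Require Import generic_quotient ring_quotient separable.
From mathcomp Require Import mathcomp_extra boolp classical_sets cardinality.
From mathcomp Require Import constructive_ereal.

Set Implicit Arguments.
Unset Strict Implicit.
Unset Printing Implicit Defensive.
Import Order.TTheory GRing.Theory Num.Theory.
Local Open Scope classical_set_scope.
Local Open Scope ring_scope.
Local Open Scope quotient_scope.

(* Values are rational: the valuations of interest extend a discrete valuation
   to an algebraic closure and to completions, so their value groups all embed
   into the divisible hull of Z. *)
Record valuation (F : fieldType) := Valuation {
  val_fun :> F -> \bar rat;
  val0 : val_fun 0 = +oo%E;
  val_fin_num : forall x, (val_fun x \is a fin_num) = (x != 0);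
  valM : forall x y, val_fun (x * y) = (val_fun x + val_fun y)%E;
  valD : forall x y,
    (Order.min (val_fun x) (val_fun y) <= val_fun (x + y))%E }.

Definition valring (F : fieldType) (v : valuation F) : {pred F} :=
  [pred x | (0 <= v x)%E].

Definition valring_of (F : fieldType) (v : valuation F) :=
  {x : F | x \in valring v}.

Definition maxideal (F : fieldType) (v : valuation F) : {pred valring_of v} :=
  [pred a | (0 < v (val a))%E].
Arguments maxideal {F} v _ /.

Section ResidueField.
Context (F : fieldType) (v : valuation F).

Lemma val1 : v 1 = 0%E.
Proof.
have : v 1 \is a fin_num by rewrite val_fin_num oner_neq0.
have := valM v 1 1; rewrite mulr1.
case: (v 1) => [r| |] // /(congr1 fine) /= h _; congr (_%:E).
by apply: (addrI r); rewrite addr0 -h.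
Qed.

Lemma valN x : v (- x) = v x.
Proof.
have hN1 : v (-1) = 0%E.
  have : v (-1) \is a fin_num by rewrite val_fin_num oppr_eq0 oner_neq0.
  have := valM v (-1) (-1); rewrite mulrNN mulr1 val1.
  case: (v (-1)) => [r| |] // /(congr1 fine) /= h _; congr (_%:E).
  by apply/eqP; move/esym/eqP: h; rewrite -mulr2n mulrn_eq0.
by rewrite -mulN1r valM hN1 add0e.
Qed.

Lemma valring_subring : subring_closed (valring v).
Proof.
split=> [|x y|x y]; rewrite !inE ?val1 // => hx hy.
  by apply: le_trans (valD v _ _); rewrite le_min hx valN.
by rewrite valM adde_ge0.
Qed.
HB.instance Definition _ := GRing.isSubringClosed.Build F (valring v)
  valring_subring.

HB.instance Definition _ := SubType.on (valring_of v).
HB.instance Definition _ := [Choice of valring_of v by <:].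
HB.instance Definition _ := [SubChoice_isSubComNzRing of valring_of v by <:].

Lemma maxideal_idealr : idealr_closed (maxideal v).
Proof.
split=> [||a x y]; rewrite !inE /= ?val0 ?val1 // => hx hy.
apply: lt_le_trans (valD v _ _).
rewrite lt_min hy andbT valM.
by have := valP a; rewrite inE /= => ha; apply: lt_le_trans hx _; apply: leeDr.
Qed.
HB.instance Definition _ := isIdealr.Build (valring_of v) (maxideal v)
  maxideal_idealr.

Definition residue_field : Type := {ideal_quot maxideal v}.
HB.instance Definition _ := GRing.ComNzRing.on residue_field.

Definition residue (x : F) : residue_field :=
  \pi_{ideal_quot maxideal v} (insubd (0 : valring_of v) x).

Definition residue_inv (q : residue_field) : residue_field :=
  residue (val (repr (q : {ideal_quot maxideal v})))^-1.

Lemma residue_pi_eq0 (a : valring_of v) :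
  (\pi_{ideal_quot maxideal v} a == 0) = (0 < v (val a))%E.
Proof.
by rewrite piE /Quotient.equiv subr0.
Qed.

Lemma residue_mulVf (q : residue_field) : q != 0 -> residue_inv q * q = 1.
Proof.
rewrite /residue_inv -{1 3}[q](@reprK _ {ideal_quot maxideal v}).
set a := repr q.
rewrite residue_pi_eq0 -leNgt => ha.
have a0 : v (val a) = 0%E.
  by apply/eqP; rewrite eq_le ha; have := valP a; rewrite inE.
have an0 : val a != 0 by rewrite -(val_fin_num v) a0.
have av0 : v (val a)^-1 = 0%E.
  by have := valM v (val a) (val a)^-1; rewrite divff // val1 a0 add0e.
rewrite /residue -pi_mulr -pi_oner; congr (\pi _).
apply: val_inj; rewrite rmorphM rmorph1 /= val_insubd inE /= av0 lexx.
by rewrite mulVf.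
Qed.

Lemma residue_inv0 : residue_inv 0 = 0.
Proof.
rewrite /residue_inv; set a := repr _.
have : (0 < v (val a))%E by rewrite -residue_pi_eq0 reprK.
rewrite /residue /insubd; case: insubP => [u|]; last by rewrite pi_zeror.
rewrite inE => hu uE ha; apply/eqP; rewrite residue_pi_eq0 uE.
have [a0|an0] := eqVneq (val a) 0; first by rewrite a0 invr0 val0.
have := valM v (val a) (val a)^-1; rewrite divff // val1 => h.
have : (0 < v (val a) + v ((val a)^-1)%R)%E by apply: (lt_le_trans ha); apply: leeDl.
by rewrite -h ltxx.
Qed.

HB.instance Definition _ :=
  GRing.ComNzRing_isField.Build residue_field residue_mulVf residue_inv0.

End ResidueField.

Definition perfect_field (k : fieldType) : Prop :=
  forall p : {poly k}, irreducible_poly p -> separable_poly p.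

(* Subfields of a field L are handled as sets in L. *)
Section Subfields.
Context (L : fieldType).
Implicit Types (A E : set L) (x : L) (p : {poly L}).

Definition is_subfield E : Prop := GRing.divring_closed (mem E).

Definition adjoin A x : set L := smallest is_subfield (A `|` [set x]).

Definition finite_extension A E : Prop :=
  [/\ is_subfield A, is_subfield E, A `<=` E &
      exists (n : nat) (b : 'I_n -> L),
        E = [set \sum_i c i * b i | c in [set c | forall i, A (c i)]]].

Definition coefs_in A p : Prop := forall i, A p`_i.

Definition algebraic_over A x : Prop :=
  exists p, [/\ p != 0, coefs_in A p & root p x].

Definition is_minpoly A x p : Prop :=
  [/\ p \is monic, coefs_in A p, root p x &
      forall q, q != 0 -> coefs_in A q -> root q x -> (size p <= size q)%N].

Definition separable_over A x : Prop :=
  exists2 p, is_minpoly A x p & separable_poly p.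

Definition separable_extension A E : Prop :=
  forall x, E x -> separable_over A x.

End Subfields.

(* [G : H], with None standing for an infinite index. *)
Definition subgroup_index (H G : set rat) : option nat :=
  let C := [set [set g + h | h in H] | g in G] in
  if `[< finite_set C >] then Some #|` fset_set C|%fset else None.

Section ValuedField.
Context (L : fieldType) (v : valuation L).
Implicit Types (A E : set L).

Definition value_group E : set rat := [set g | exists2 x, E x & v x = g%:E].

Definition ramification_index A E : option nat :=
  subgroup_index (value_group A) (value_group E).

(* The residue field of the valued subfield E of L, inside that of L. *)
Definition residue_subfield E : set (residue_field v) :=
  residue v @` (E `&` [set x | x \in valring v]).

Definition unramified A E : Prop :=
  [/\ finite_extension A E, ramification_index A E = Some 1%N &
      separable_extension (residue_subfield A) (residue_subfield E)].

Definition totally_ramified A E : Prop :=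
  finite_extension A E /\ residue_subfield E = residue_subfield A.

Definition max_unramified A : set L :=
  smallest (@is_subfield L) (\bigcup_(E in [set E | unramified A E]) E).

Definition val_closure A : set L :=
  [set x | forall M : rat, exists2 y, A y & (M%:E <= v (x - y)%R)%E].

Definition val_cauchy (u : nat -> L) : Prop :=
  forall M : rat, exists N, forall m n, (N <= m)%N -> (N <= n)%N ->
    (M%:E <= v (u m - u n)%R)%E.

Definition val_cvg (u : nat -> L) (l : L) : Prop :=
  forall M : rat, exists N, forall n, (N <= n)%N -> (M%:E <= v (u n - l)%R)%E.

Definition val_complete : Prop :=
  forall u, val_cauchy u -> exists l, val_cvg u l.

(* The elements s of L with e(A(s) | A) finite. *)
Definition bounded_ramification A : set L :=
  [set s | ramification_index A (adjoin A s) <> None].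

End ValuedField.

Definition extends_val (F L : fieldType) (v : valuation F) (w : valuation L)
  (i : {rmorphism F -> L}) : Prop := forall x, w (i x) = v x.

Definition is_completion (F L : fieldType) (v : valuation F) (w : valuation L)
  (i : {rmorphism F -> L}) : Prop :=
  [/\ extends_val v w i, val_complete w & val_closure w (range i) = setT].

Definition is_algebraic_closure (F : fieldType) (L : closedFieldType)
  (i : {rmorphism F -> L}) : Prop := forall x, algebraicOver i x.

(* V is a DVR and v is its associated valuation: v has valuation ring V and
   value group isomorphic to Z. *)
Definition is_dvr_valuation (V : idomainType) (v : valuation {fraction V}) : Prop :=
  (forall x, x \in valring v <-> exists a : V, x = tofrac a) /\
  (exists2 g : rat, 0 < g & value_group v setT = range (fun n : int => g *~ n)).

(* Main.v *)
From HB Require Import structures.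
From mathcomp Require Import all_boot all_order all_algebra finmap.
From mathcomp Require Import fieldext separable generic_quotient ring_quotient.
From mathcomp Require Import mathcomp_extra boolp classical_sets cardinality.
From mathcomp Require Import constructive_ereal.
From mathcomp Require Import ring lra zify.
Require Import Defs.

(** The proof takes place inside the complete field KK. Let g Z be the value
    group of K, and write Khat, Kur and C for the images in KK of the
    completion of K and of its maximal unramified extension, and for the
    closure of the latter. The two properties of C that matter are that it
    contains all residues of KK and that its value group is still g Z.

    Residues. An integral y in the algebraic closure has a residue
    algebraic over the residue field k of V, with a minimal polynomial that
    is separable because k is perfect. Lift it to a monic H over V. Since
    H(y) has positive value and H splits, some root u of H has the residue
    of y. A polynomial in u of degree less than deg H with primitive
    integral coefficients has a nonzero residue, by minimality; so Khat(u)
    has no new values and is unramified ([unramified_near]). Hence C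
    contains every residue ([KKur_residually_dense]). In particular no
    extension of C inside KK has a larger residue field.

    Values. Let A be a subfield of KK containing Khat with values in d Z.
    By Zorn's lemma there is a maximal subfield B above A with values in d
    Z. It is closed, and Hensel's lemma shows that it contains every residue
    ([maximal_discrete]). Then B contains every unramified extension E of
    Khat: a residue of E is a simple root of some reduced H, Hensel's lemma
    in E and in B produces roots of H, and these are equal because simple
    roots are determined by their residues; so E is in the closure of its
    intersection with B ([unramified_sub]). Thus B contains C
    ([KKur_in_discrete]). For A = Khat this shows that C has values in
    g Z, and for A = Khat(a) it controls the values of C(a).

    Finite ramification index of Khat(a) means that its values lie in (g /
    N) Z for some N. If so, the values of C(a) lie there too. Pick one
    element of C(a) in each class of values modulo g Z that occurs. As C
    contains all residues, successive approximation expresses every element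
    of C(a) as a combination of the picked elements with coefficients in the
    complete field C. So C(a) is finite over C and a is algebraic
    ([KKbr_algebraic]). Conversely, if a is algebraic over C, then every
    nonzero y in C(a) satisfies a relation of bounded degree over C, in
    which two terms have the same value; this bounds the denominators of the
    values of C(a) ([algebraic_KKbr]). Finally, the elements algebraic over
    a field form a field. *)

Set Implicit Arguments.
Unset Strict Implicit.
Unset Printing Implicit Defensive.
Import Order.TTheory GRing.Theory Num.Theory.
Local Open Scope classical_set_scope.
Local Open Scope ring_scope.
Local Open Scope quotient_scope.

(** * Valuations and integral polynomials *)

Section ValuationBasics.
Context (L : fieldType) (w : valuation L).
Implicit Types (x y z : L) (r s : rat) (e : \bar rat) (p q h : {poly L}).

Lemma val_finE x : x != 0 -> exists r, w x = r%:E.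
Proof. by rewrite -(val_fin_num w) => /fineK <-; exists (fine (w x)). Qed.

Lemma val_eqy x : (w x = +oo)%E -> x = 0.
Proof.
by move=> wx; apply/eqP; apply: contraT => /val_finE[r]; rewrite wx.
Qed.

Lemma val_geD e x y : (e <= w x)%E -> (e <= w y)%E -> (e <= w (x + y)%R)%E.
Proof. by move=> ex ey; apply: le_trans (valD w x y); rewrite le_min ex. Qed.

Lemma val_geB e x y : (e <= w x)%E -> (e <= w y)%E -> (e <= w (x - y)%R)%E.
Proof. by move=> ex ey; apply: val_geD; rewrite ?valN. Qed.

Lemma val_gtD e x y : (e < w x)%E -> (e < w y)%E -> (e < w (x + y)%R)%E.
Proof. by move=> ex ey; apply: lt_le_trans (valD w x y); rewrite lt_min ex. Qed.

Lemma val_gtB e x y : (e < w x)%E -> (e < w y)%E -> (e < w (x - y)%R)%E.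
Proof. by move=> ex ey; apply: val_gtD; rewrite ?valN. Qed.

Lemma val_subC x y : w (x - y) = w (y - x).
Proof. by rewrite -(valN w (x - y)) opprB. Qed.

Lemma val_geM r s x y :
  (r%:E <= w x)%E -> (s%:E <= w y)%E -> ((r + s)%:E <= w (x * y)%R)%E.
Proof.
by move=> rx sy; rewrite valM EFinD; apply: leeD.
Qed.

Lemma val_dist e x y z :
  (e <= w (x - y)%R)%E -> (e <= w (y - z)%R)%E -> (e <= w (x - z)%R)%E.
Proof. by move=> h1 h2; rewrite -(subrK y x) -addrA; apply: val_geD. Qed.

Lemma val_dist_gt e x y z :
  (e < w (x - y)%R)%E -> (e < w (y - z)%R)%E -> (e < w (x - z)%R)%E.
Proof. by move=> h1 h2; rewrite -(subrK y x) -addrA; apply: val_gtD. Qed.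

Lemma valV r x : w x = r%:E -> w x^-1 = (- r)%:E.
Proof.
move=> wx; have x0 : x != 0 by rewrite -(val_fin_num w) wx.
have [s ws] : exists s, w x^-1 = s%:E by apply: val_finE; rewrite invr_eq0.
have := valM w x x^-1; rewrite divff // val1 wx ws => -[/esym/eqP].
by rewrite addrC addr_eq0 => /eqP->.
Qed.

Lemma val_unit_div x y : x != 0 -> w x = w y -> w (x / y) = 0%E.
Proof.
move=> /val_finE[r wx]; rewrite valM wx => /esym wy.
by rewrite (valV wy) -EFinD subrr.
Qed.

(** The ultrametric inequality is an equality as soon as the two values
    differ. *)
Lemma val_dominant x y : (w x < w (x - y)%R)%E -> w y = w x.
Proof.
move=> h; apply/eqP; rewrite eq_le; apply/andP; split; last first.
  have -> : w y = w (x - (x - y)) by rewrite subKr.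
  by apply: val_geB => //; apply: ltW.
rewrite leNgt; apply/negP => h'.
by have := val_gtD h h'; rewrite subrK ltxx.
Qed.

Lemma valringE x : (x \in valring w) = (0 <= w x)%E. Proof. by []. Qed.

Lemma val_posM x y : x \in valring w -> (0 < w y)%E -> (0 < w (x * y)%R)%E.
Proof.
rewrite valringE valM => x0 y0.
by apply: lt_le_trans y0 _; apply: leeDr.
Qed.

Lemma val_pos_sum (I : Type) (s : seq I) (P : pred I) (F : I -> L) e :
  (e < +oo)%E ->
  (forall i, P i -> (e < w (F i))%E) -> (e < w (\sum_(i <- s | P i) F i)%R)%E.
Proof.
move=> ey F0; elim/big_ind: _ => //; first by rewrite val0.
by move=> x y; apply: val_gtD.
Qed.

Lemma val_pos_horner p x :
  (forall i, 0 < w p`_i)%E -> x \in valring w -> (0 < w p.[x])%E.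
Proof.
move=> p0 x0; rewrite horner_coef; apply: val_pos_sum => // i _.
by rewrite mulrC; apply: val_posM; rewrite ?rpredX.
Qed.

Lemma val_unitP x : x \in valring w -> ~ (0 < w x)%E -> w x = 0%E.
Proof.
by rewrite valringE => h /negP; rewrite -leNgt => h'; apply/eqP; rewrite eq_le h h'.
Qed.

Lemma val_pos_int x : (0 < w x)%E -> x \in valring w.
Proof. by rewrite valringE; apply: ltW. Qed.

Lemma val0_int x : w x = 0%E -> x \in valring w.
Proof. by rewrite valringE => ->. Qed.

Lemma valX x n r : w x = r%:E -> w (x ^+ n) = (r *+ n)%:E.
Proof.
move=> wx; elim: n => [|n IH]; first by rewrite val1.
by rewrite exprS valM IH wx mulrS -EFinD.
Qed.

(** The divided derivatives of an integral polynomial are integral, so the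
    Taylor expansion stays integral without dividing by factorials. *)
Lemma integral_taylor2 p x y : p \is a polyOver (valring w) ->
  x \in valring w -> y \in valring w ->
  exists2 z, z \in valring w & p.[x + y] = p.[x] + p^`().[x] * y + y ^+ 2 * z.
Proof.
move=> pO xO yO; rewrite (nderiv_taylor_wide (n := (size p).+2)); last 2 first.
- exact: mulrC.
- by rewrite leqW.
rewrite big_ord_recl big_ord_recl /= nderivn0 expr0 mulr1 expr1 nderivn1.
exists (\sum_(i < size p) p^`N(i.+2).[x] * y ^+ i).
  apply: rpred_sum => i _; apply: rpredM; last exact: rpredX.
  by apply: rpred_horner => //; apply: polyOver_nderivn.
rewrite addrA mulr_sumr; congr (_ + _); apply: eq_bigr => i _.
by rewrite -[bump 0 _]/(i.+2) !exprS expr0; ring.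
Qed.

Lemma integral_taylor1 p x y : p \is a polyOver (valring w) ->
  x \in valring w -> y \in valring w ->
  exists2 z, z \in valring w & p.[x] - p.[y] = (x - y) * z.
Proof.
move=> pO xO yO; have dO : x - y \in valring w by rewrite rpredB.
have [z zO /eqP] := integral_taylor2 pO yO dO.
rewrite addrC subrK -addrA addrC -subr_eq => /eqP ->.
exists (p^`().[y] + (x - y) * z); last by ring.
by rewrite rpredD ?rpredM ?rpred_horner ?polyOver_deriv.
Qed.

Lemma val_horner_congr p x y : p \is a polyOver (valring w) ->
  x \in valring w -> y \in valring w -> (0 < w (x - y)%R)%E ->
  (0 < w (p.[x] - p.[y])%R)%E.
Proof.
move=> pO xO yO xy; have [z zO ->] := integral_taylor1 pO xO yO.
by rewrite mulrC val_posM.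
Qed.

Lemma valring_congr x y : x \in valring w -> (0 < w (x - y)%R)%E -> y \in valring w.
Proof. by move=> xO /val_pos_int xy; rewrite -(subKr x y) rpredB. Qed.

Lemma val_congr0 x y : w x = 0%E -> (0 < w (x - y)%R)%E -> w y = 0%E.
Proof. by move=> x0 xy; rewrite (@val_dominant x y) // x0. Qed.

(** If y = x + t with t of positive value, the expansion at x reads 0 = t
    (p'(x) + t z), whose second factor is a unit. *)
Lemma simple_root_unique p x y : p \is a polyOver (valring w) ->
  x \in valring w -> (0 < w (y - x)%R)%E -> w p^`().[x] = 0%E ->
  p.[x] = 0 -> p.[y] = 0 -> x = y.
Proof.
move=> pO xO xy p'x px py; have dO := val_pos_int xy.
have [z zO] := integral_taylor2 pO xO dO.
rewrite addrC subrK py px add0r => /esym/eqP.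
have -> : p^`().[x] * (y - x) + (y - x) ^+ 2 * z =
          (y - x) * (p^`().[x] + z * (y - x)) by ring.
rewrite mulf_eq0 => /orP[|/eqP e]; first by rewrite subr_eq0 => /eqP.
have := @val_congr0 p^`().[x] 0 p'x.
rewrite subr0 -(addrK (z * (y - x)) (p^`().[x])) e add0r valN.
by rewrite val_posM // val0 => /(_ erefl).
Qed.

End ValuationBasics.

(** * Subfields given as sets *)

Lemma is_subfieldP (L : fieldType) (E : set L) :
  is_subfield E <->
  [/\ E 1, forall x y, E x -> E y -> E (x - y)
         & forall x y, E x -> E y -> E (x / y)].
Proof.
split=> -[E1 EB EV]; split=> [|x y|x y].
- by move: E1; rewrite in_setE.
- by have := EB x y; rewrite !in_setE.
- by have := EV x y; rewrite !in_setE.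
- by rewrite in_setE.
- by have := EB x y; rewrite !in_setE.
- by have := EV x y; rewrite !in_setE.
Qed.

(** Carrying the proof hA makes room for the canonical structure of a
    subfield, which a bare set cannot have. *)
Definition subfield_mem (L : fieldType) (A : set L) (hA : is_subfield A) :
  {pred L} := mem A.

Section SubfieldClosed.
Context (L : fieldType) (A : set L) (hA : is_subfield A).

HB.instance Definition _ :=
  GRing.isDivringClosed.Build L (subfield_mem hA) hA.

Lemma subfield_memE x : (x \in subfield_mem hA) <-> A x.
Proof. by rewrite /subfield_mem; split; rewrite in_setE. Qed.

Lemma subfield1 : A 1. Proof. exact/subfield_memE/rpred1. Qed.
Lemma subfield0 : A 0. Proof. exact/subfield_memE/rpred0. Qed.

Lemma subfieldD x y : A x -> A y -> A (x + y).
Proof. by move=> /subfield_memE ? /subfield_memE ?; apply/subfield_memE/rpredD. Qed.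

Lemma subfieldB x y : A x -> A y -> A (x - y).
Proof. by move=> /subfield_memE ? /subfield_memE ?; apply/subfield_memE/rpredB. Qed.

Lemma subfieldM x y : A x -> A y -> A (x * y).
Proof. by move=> /subfield_memE ? /subfield_memE ?; apply/subfield_memE/rpredM. Qed.

Lemma subfieldV x : A x -> A x^-1.
Proof. by move=> /subfield_memE ?; apply/subfield_memE; rewrite rpredV. Qed.

Lemma subfieldXz x (m : int) : A x -> A (x ^ m).
Proof.
have AX n : A x -> A (x ^+ n).
  by move=> /subfield_memE ?; apply/subfield_memE/rpredX.
by case: m => n Ax; [apply: AX|rewrite NegzE -exprnN; apply/subfieldV/AX].
Qed.

Lemma subfield_sum (I : Type) (s : seq I) (P : pred I) (F : I -> L) :
  (forall i, P i -> A (F i)) -> A (\sum_(i <- s | P i) F i).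
Proof. by move=> AF; apply/subfield_memE/rpred_sum => i /AF/subfield_memE. Qed.

Lemma subfieldX x n : A x -> A (x ^+ n).
Proof. exact: (@subfieldXz x n). Qed.

Lemma subfield_horner p x : coefs_in A p -> A x -> A p.[x].
Proof.
by move=> Ap Ax; rewrite horner_coef; apply: subfield_sum => i _; apply/subfieldM/subfieldX.
Qed.

End SubfieldClosed.

Section SubfieldType.
Context (L : fieldType) (A : set L) (hA : is_subfield A).

Definition subfield_type := {x : L | x \in subfield_mem hA}.
HB.instance Definition _ := SubType.on subfield_type.
HB.instance Definition _ := [Choice of subfield_type by <:].
HB.instance Definition _ := [SubChoice_isSubIntegralDomain of subfield_type by <:].
HB.instance Definition _ := [SubIntegralDomain_isSubField of subfield_type by <:].

Definition sf_val : subfield_type -> L := \val.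
HB.instance Definition _ := GRing.RMorphism.on sf_val.

Lemma sf_valP (c : subfield_type) : A (sf_val c).
Proof. exact/(subfield_memE hA)/(valP c). Qed.

Lemma sf_valK x : A x -> exists c, sf_val c = x.
Proof. by move=> /(subfield_memE hA) Ax; exists (Sub x Ax); apply: SubK. Qed.

Lemma coefs_inP p : coefs_in A p <-> exists P : {poly subfield_type}, p = map_poly sf_val P.
Proof.
split=> [Ap|[P ->] i]; last by rewrite coef_map; apply: sf_valP.
have /choice[f fE] i : exists c, sf_val c = p`_i by apply: sf_valK.
exists (\poly_(i < size p) f i); apply/polyP => i.
rewrite coef_map coef_poly; case: ltnP => [_|ip] /=; first by rewrite -(fE i).
by rewrite rmorph0 nth_default.
Qed.

Lemma coefs_inD p q : coefs_in A p -> coefs_in A q -> coefs_in A (p + q).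
Proof. by move=> Ap Aq i; rewrite coefD; apply: (subfieldD hA). Qed.

Lemma coefs_inM p q : coefs_in A p -> coefs_in A q -> coefs_in A (p * q).
Proof.
by move=> Ap Aq i; rewrite coefM; apply: (subfield_sum hA) => j _; apply: (subfieldM hA).
Qed.

Lemma coefs_inZ c p : A c -> coefs_in A p -> coefs_in A (c *: p).
Proof. by move=> Ac Ap i; rewrite coefZ; apply: (subfieldM hA). Qed.

Lemma algebraic_overE x : algebraic_over A x <-> algebraicOver sf_val x.
Proof.
split=> [[p [p0 /coefs_inP[P pE] px]]|[P P0 Px]].
  by exists P; [rewrite -(map_poly_eq0 sf_val) -pE|rewrite -pE].
exists (map_poly sf_val P); split=> //; first by rewrite map_poly_eq0.
by apply/coefs_inP; exists P.
Qed.

(** The coordinates form a matrix over the subfield with more rows than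
    columns; a nonzero vector of its kernel gives the relation. *)
Lemma span_dependent m n (b : 'I_n -> L) (y : 'I_m -> L) : (n < m)%N ->
  (forall i, exists2 c : 'I_n -> L, (forall j, A (c j)) & y i = \sum_j c j * b j) ->
  exists c : 'I_m -> L, [/\ forall i, A (c i), exists i, c i != 0 &
    \sum_i c i * y i = 0].
Proof.
move=> nm span.
have /choice[c cE] i : exists c : 'I_n -> L,
    (forall j, A (c j)) /\ y i = \sum_j c j * b j.
  by have [c] := span i; exists c.
have /choice[d dE] (ij : 'I_m * 'I_n) : exists e, sf_val e = c ij.1 ij.2.
  by apply: sf_valK; apply: (cE _).1.
pose M := \matrix_(i < m, j < n) d (i, j).
have : kermx M != 0.
  rewrite -mxrank_eq0 mxrank_ker subn_eq0 -ltnNge.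
  by apply: leq_ltn_trans nm; apply: rank_leq_col.
case/rowV0Pn => v /sub_kermxP vM v0; exists (fun i => sf_val (v 0 i)); split.
- by move=> i; apply: sf_valP.
- have /rV0Pn[i vi] := v0; exists i; by rewrite fmorph_eq0.
under eq_bigr => i _ do rewrite (cE i).2 mulr_sumr.
rewrite exchange_big big1 //= => j _.
transitivity (sf_val ((v *m M) 0 j) * b j); last by rewrite vM mxE rmorph0 mul0r.
rewrite mxE rmorph_sum mulr_suml; apply: eq_bigr => i _.
by rewrite rmorphM mulrA mxE; congr (_ * _ * _); rewrite -[LHS]/(c i j) -(dE (i, j)).
Qed.

(** The first n + 1 powers of x are dependent, hence a bound on the degree. *)
Lemma span_algebraic n (b : 'I_n -> L) x :
  (forall k, exists2 c : 'I_n -> L, (forall j, A (c j)) & x ^+ k = \sum_j c j * b j) ->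
  exists p, [/\ p != 0, coefs_in A p, root p x & (size p <= n.+1)%N].
Proof.
move=> span; have [|c [Ac [i ci] c0]] := @span_dependent n.+1 n b (fun k => x ^+ k) (leqnn _).
  by move=> k; apply: span.
pose p := \poly_(k < n.+1) c (inord k).
have pE (k : 'I_n.+1) : p`_k = c k by rewrite coef_poly ltn_ord inord_val.
exists p; split.
- by apply: contraNneq ci => p0; rewrite -pE p0 coef0.
- by move=> k; rewrite coef_poly; case: ifP => // _; apply: (subfield0 hA).
- rewrite /root /p horner_poly -[X in _ == X]c0; apply/eqP/eq_bigr => k _.
  by rewrite inord_val.
- exact: size_poly.
Qed.

Lemma adjoin_subfield x : is_subfield (adjoin A x).
Proof.
apply/is_subfieldP; split=> [B [/is_subfieldP[] //]|y z|y z] Ey Ez B HB;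
  have /is_subfieldP[_ hB hV] := HB.1; [apply: hB|apply: hV]; (exact: Ey || exact: Ez).
Qed.

Lemma adjoin_sub x : A `<=` adjoin A x.
Proof. by move=> y Ay B [_]; apply; left. Qed.

Lemma adjoin_gen x : adjoin A x x.
Proof. by move=> B [_]; apply; right. Qed.

Lemma adjoin_min x (B : set L) : is_subfield B -> A `<=` B -> B x -> adjoin A x `<=` B.
Proof. by move=> hB AB Bx y; apply; split=> // z [/AB|->]. Qed.

(** The polynomial expressions in an algebraic x already form a field, being
    the image of an abstract simple extension; reduction modulo h bounds
    the degree. *)
Lemma adjoinE x h : h != 0 -> coefs_in A h -> root h x ->
  adjoin A x = [set p.[x] | p in [set p | coefs_in A p /\ (size p < size h)%N]].
Proof.
move=> h0 /coefs_inP[H hE] hx.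
have H0 : H != 0 by rewrite -(map_poly_eq0 sf_val) -hE.
have Hx : root (map_poly sf_val H) x by rewrite -hE.
pose i := @subfx_inj _ _ sf_val x H.
have iE (P : {poly subfield_type}) : i (subfx_eval sf_val x H P) = (map_poly sf_val P).[x].
  exact: subfx_inj_eval.
apply/seteqP; split; last first.
  move=> _ [p [Ap _] <-] B [hB HB]; apply: (subfield_horner hB).
    by move=> k; apply: HB; left; apply: Ap.
  by apply: HB; right.
have -> : [set p.[x] | p in [set p | coefs_in A p /\ (size p < size h)%N]] = range i.
  apply/seteqP; split=> [_ [p [/coefs_inP[P ->] _] <-]|_ [t _ <-]].
    by exists (subfx_eval sf_val x H P); rewrite ?iE.
  have [P ->] := subfxE t.
  exists (map_poly sf_val (P %% H)).
    split; first by apply/coefs_inP; exists (P %% H).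
    by rewrite hE !size_map_poly ltn_modp.
  rewrite iE {2}(divp_eq P H) rmorphD rmorphM /= hornerD hornerM.
  by rewrite (eqP Hx) mulr0 add0r.
apply: adjoin_min.
- apply/is_subfieldP; split; first by exists 1; rewrite /i ?rmorph1.
  + by move=> _ _ [s _ <-] [t _ <-]; exists (s - t); rewrite /i ?rmorphB.
  + by move=> _ _ [s _ <-] [t _ <-]; exists (s / t); rewrite /i ?fmorph_div.
- move=> y /sf_valK[c <-]; exists (subfx_eval sf_val x H c%:P) => //.
  by rewrite iE map_polyC hornerC.
- by exists (subfx_root sf_val x H) => //; apply: subfx_inj_root.
Qed.

Lemma adjoin_finite x : algebraic_over A x -> finite_extension A (adjoin A x).
Proof.
move=> [h [h0 Ah hx]]; split=> //; [exact: adjoin_subfield|exact: adjoin_sub|].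
exists (size h).-1, (fun i => x ^+ i).
have szh : (0 < size h)%N by rewrite size_poly_gt0.
rewrite (adjoinE h0 Ah hx); apply/seteqP; split.
  move=> _ [p [Ap ph] <-]; exists (fun i : 'I__ => p`_i) => /=; first by move=> i; apply: Ap.
  by rewrite (@horner_coef_wide _ (size h).-1) // -ltnS prednK.
move=> _ [c Ac <-]; exists (\poly_(i < (size h).-1) (oapp c 0 (insub i))).
  split.
    move=> i; rewrite coef_poly; case: ifP => [ih|_]; last exact: (subfield0 hA).
    by rewrite insubT /=.
  by apply: leq_ltn_trans (size_poly _ _) _; rewrite ltn_predL.
rewrite horner_poly; apply: eq_bigr => i _.
by rewrite valK.
Qed.

Lemma algebraic_finite E x : finite_extension A E -> E x -> algebraic_over A x.
Proof.
move=> [_ hE _ [n [b EE]]] Ex.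
have [|p [p0 Ap px _]] := @span_algebraic n b x; last by exists p.
move=> k; have : E (x ^+ k) by apply: subfieldX.
by rewrite {1}EE => -[c Ac <-]; exists c.
Qed.

Lemma algebraic_subfield : is_subfield [set x | algebraic_over A x].
Proof.
apply/is_subfieldP; split=> [|x y|x y].
- by apply/algebraic_overE/algebraic1.
- by move=> /algebraic_overE ? /algebraic_overE ?; apply/algebraic_overE/algebraic_sub.
- by move=> /algebraic_overE ? /algebraic_overE ?; apply/algebraic_overE/algebraic_div.
Qed.

End SubfieldType.

(** * Closures, Hensel's lemma and finite-dimensional spaces *)

Lemma rat_arch (d M : rat) : 0 < d -> exists N, forall n, (N <= n)%N -> M <= d *+ n.
Proof.
move=> d0; exists (Num.bound (`|M| / d)) => n Nn.
have Md : 0 <= `|M| / d by rewrite divr_ge0 // ltW.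
have := archi_boundP Md; rewrite ltr_pdivrMr // => lt1.
apply: le_trans (ler_norm M) _; apply: le_trans (ltW lt1) _.
by rewrite mulr_natl ler_pMn2l.
Qed.

Section Closure.
Context (L : fieldType) (w : valuation L).
Implicit Types (x y z : L) (A B C W : set L) (p h : {poly L}).

Definition val_closed A := val_closure w A `<=` A.

(** The nonzero values lie in d Z, but need not exhaust it. This one-sided
    form passes to subfields, and finite ramification over a discrete
    field amounts to replacing d by some d / N. *)
Definition discrete (d : rat) A :=
  forall x, A x -> x != 0 -> exists m : int, w x = (d *~ m)%:E.

Lemma val_lb x : exists r : rat, (r%:E <= w x)%E.
Proof.
have [->|/(val_finE w)[r ->]] := eqVneq x 0; last by exists r.
by exists 0; rewrite val0 leey.
Qed.

Lemma val_ge_all x : (forall M : rat, (M%:E <= w x)%E) -> x = 0.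
Proof.
move=> h; apply/eqP; apply: contraT => /(val_finE w)[r wx].
by have := h (r + 1); rewrite wx lee_fin gerDl ler10.
Qed.

Lemma sub_closure A : A `<=` val_closure w A.
Proof. by move=> x Ax M; exists x => //; rewrite subrr val0 leey. Qed.

Lemma closure_mono A B : A `<=` B -> val_closure w A `<=` val_closure w B.
Proof. by move=> AB x Ax M; have [y /AB By xy] := Ax M; exists y. Qed.

Lemma closure_closed A : val_closed (val_closure w A).
Proof.
move=> x Ax M; have [y Ay xy] := Ax M; have [z Az yz] := Ay M.
by exists z => //; apply: val_dist yz.
Qed.

Lemma closure_gt A x (e : \bar rat) : (e < +oo)%E -> val_closure w A x ->
  exists2 y, A y & (e < w (x - y)%R)%E.
Proof.
case: e => [r| |] // _ Ax; last first.
  by have [y Ay xy] := Ax 0; exists y => //; apply: lt_le_trans xy.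
have [y Ay xy] := Ax (r + 1); exists y => //; apply: lt_le_trans xy.
by rewrite lte_fin ltrDl.
Qed.

Lemma closure_value A x : val_closure w A x -> x != 0 ->
  exists y, [/\ A y, y != 0 & w y = w x].
Proof.
move=> Ax /(val_finE w)[r wx].
have [|y Ay xy] := @closure_gt A x (w x) _ Ax; first by rewrite wx ltry.
have wy := val_dominant xy; exists y; split=> //.
by rewrite -(val_fin_num w) wy wx.
Qed.

Lemma discrete_closure d A : discrete d A -> discrete d (val_closure w A).
Proof.
move=> dA x Ax x0; have [y [Ay y0 <-]] := closure_value Ax x0.
exact: dA.
Qed.

Lemma closure_subfield A : is_subfield A -> is_subfield (val_closure w A).
Proof.
move=> hA.
have cM x y : val_closure w A x -> val_closure w A y -> val_closure w A (x * y).
  move=> cx cy M; have [r rx] := val_lb x; have [s sy] := val_lb y.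
  have [x' Ax' xx'] := cx (Order.max (M - s) r).
  have [y' Ay' yy'] := cy (M - r).
  move: xx'; rewrite EFin_max ge_max => /andP[xx'1 xx'2].
  have rx' : (r%:E <= w x')%E by rewrite -(subKr x x'); apply: val_geB.
  exists (x' * y'); first exact: subfieldM.
  have -> : x * y - x' * y' = (x - x') * y + x' * (y - y') by ring.
  apply: val_geD; first by rewrite -[M](subrK s); apply: val_geM.
  have -> : M = r + (M - r) by ring.
  exact: val_geM.
have cV y : val_closure w A y -> val_closure w A y^-1.
  move=> cy; have [->|y0] := eqVneq y 0.
    by rewrite invr0; apply: sub_closure; apply: subfield0.
  have [r wy] := val_finE w y0; move=> M.
  have [y' Ay'] := cy (Order.max (M + (r + r)) (r + 1)).
  rewrite EFin_max ge_max => /andP[yy'1 yy'2].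
  have wy' : w y' = r%:E.
    rewrite -wy; apply: val_dominant; apply: lt_le_trans yy'2.
    by rewrite wy lte_fin ltrDl.
  have y'0 : y' != 0 by rewrite -(val_fin_num w) wy'.
  exists y'^-1; first exact: subfieldV.
  have -> : y^-1 - y'^-1 = (y' - y) * (y^-1 * y'^-1).
    by field; rewrite y0 y'0.
  rewrite -[M](addrK (r + r)) [- (r + r)]opprD; apply: val_geM; first by rewrite val_subC.
  by apply: val_geM; rewrite (valV wy, valV wy').
apply/is_subfieldP; split=> [|x y cx cy|x y cx cy].
- by apply: sub_closure; apply: subfield1.
- move=> M; have [x' Ax' xx'] := cx M; have [y' Ay' yy'] := cy M.
  exists (x' - y'); first exact: subfieldB.
  have -> : x - y - (x' - y') = (x - x') - (y - y') by ring.
  exact: val_geB.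
- by apply: cM => //; apply: cV.
Qed.

Lemma cvg_closure A (u : nat -> L) l : (forall n, A (u n)) -> val_cvg w u l ->
  val_closure w A l.
Proof.
move=> Au ul M; have [N h] := ul M; exists (u N) => //.
by rewrite val_subC; apply: h.
Qed.

Lemma closed_preimage A B : val_closed A -> val_closed B -> val_closed (A `&` B).
Proof.
move=> cA cB x cx; split; [apply: cA|apply: cB]; apply: closure_mono cx => y [];
  done.
Qed.

(** Successive approximation: each correction by an element of D strictly
    raises the value of the error, hence by at least d, so the errors
    tend to infinity. *)
Lemma closure_dense_leading d Y D : 0 < d -> discrete d Y ->
  D `<=` Y -> (forall x y, Y x -> Y y -> Y (x - y)) ->
  D 0 -> (forall x y, D x -> D y -> D (x + y)) ->
  (forall y, Y y -> y != 0 -> exists2 c, D c & (w y < w (y - c)%R)%E) ->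
  Y `<=` val_closure w D.
Proof.
move=> d0 dY DY YB D0 DD lead y Yy.
have [->|y0] := eqVneq y 0; first exact: sub_closure.
have [m wy] := dY y Yy y0.
have step n : exists2 c, D c & ((d *~ (m + n%:Z))%:E <= w (y - c)%R)%E.
  elim: n => [|n [c Dc yc]]; first by exists 0 => //; rewrite (subr0 y) addr0 wy.
  have Yyc : Y (y - c) by apply: YB => //; apply: DY.
  have [e0|yc0] := eqVneq (y - c) 0.
    by exists c => //; rewrite e0 val0 leey.
  have [c' Dc' yc'] := lead _ Yyc yc0.
  exists (c + c'); first exact: DD.
  have Yz : Y (y - (c + c')) by apply: YB => //; apply: DY; apply: DD.
  have [e0|z0] := eqVneq (y - (c + c')) 0; first by rewrite e0 val0 leey.
  have [[k wk] [l wl]] := (dY _ Yyc yc0, dY _ Yz z0).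
  move: yc'; rewrite -addrA -opprD wl wk lte_fin (ltr_pMz2l d0) => kl.
  move: yc; rewrite wk !lee_fin !(ler_pMz2l d0) => mk.
  by rewrite -addn1 PoszD addrA lezD1; apply: le_lt_trans mk kl.
move=> M; have [N hN] := rat_arch (M - d *~ m) d0.
have [c Dc yc] := step N; exists c => //; apply: le_trans yc.
by rewrite lee_fin mulrzDr -lerBlDl; apply: hN.
Qed.

End Closure.

Section Complete.
Context (L : fieldType) (w : valuation L) (wc : val_complete w).
Implicit Types (x y z : L) (A B C W : set L) (p h : {poly L}).

(** The simplified Newton iteration y - h(y) / h'(x), with the derivative
    frozen at the starting point, gains the fixed amount w(h(x)) at each
    step, and it never leaves B. *)
Lemma hensel B h x : is_subfield B -> val_closed w B ->
  h \is a polyOver (valring w) -> coefs_in B h -> x \in valring w -> B x ->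
  (0 < w h.[x])%E -> w h^`().[x] = 0%E ->
  exists y, [/\ B y, h.[y] = 0 & (0 < w (y - x)%R)%E].
Proof.
move=> hB cB hO Bh xO Bx hx h'x.
set c := h^`().[x].
have Bc : B c.
  apply: subfield_horner => // i; rewrite coef_deriv -mulr_natr.
  apply: subfieldM => //; elim: i.+1 => [|n IH]; first exact: subfield0.
  by rewrite mulrS; apply: subfieldD => //; apply: subfield1.
have h'O : h^`() \is a polyOver (valring w) by apply: polyOver_deriv.
have wcV : w c^-1 = 0%E by have := valV h'x; rewrite oppr0.
have c0 : c != 0 by rewrite -(val_fin_num w) h'x.
have cVO := val0_int wcV.
(* Any positive bound serves when x is already a root. *)
have [d d0 dx] : exists2 d : rat, 0 < d & (d%:E <= w h.[x])%E.
  have [e|/(val_finE w)[r wr]] := eqVneq h.[x] 0.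
    by exists 1 => //; rewrite e val0 leey.
  by exists r; rewrite ?wr //; move: hx; rewrite wr lte_fin.
pose phi y := y - h.[y] / c.
pose u n := iter n phi x.
have inv n : [/\ B (u n), (d%:E <= w (u n - x)%R)%E &
                 ((d *+ n.+1)%:E <= w h.[u n])%E].
  elim: n => [|n [Bu ux hu]]; first by split=> //; rewrite subrr val0 leey.
  have uO : u n \in valring w.
    apply: (@valring_congr _ w x) => //; rewrite val_subC.
    by apply: lt_le_trans ux; rewrite lte_fin.
  have he : ((d *+ n.+1)%:E <= w (h.[u n] / c)%R)%E.
    by rewrite valM wcV adde0.
  have dn : (d%:E <= (d *+ n.+1)%:E)%E.
    by rewrite lee_fin mulrS lerDl mulrn_wge0 // ltW.
  have eO : - (h.[u n] / c) \in valring w.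
    by rewrite rpredN rpredM // rpred_horner.
  rewrite /u iterS -/(u n) /phi; split.
  - by apply: subfieldB => //; apply: (subfieldM hB); [apply: subfield_horner|apply: subfieldV].
  - by rewrite addrAC; apply: val_geB => //; apply: le_trans he.
  have [z zO ->] := integral_taylor2 hO uO eO.
  have [t tO ct] := integral_taylor1 h'O xO uO.
  (* With e = h(u n) / c the new value is e (c - h'(u n)) + e ^ 2 z, and the
     factor c - h'(u n) = h'(x) - h'(u n) has value at least d. *)
  have -> : h.[u n] + h^`().[u n] * - (h.[u n] / c) + (- (h.[u n] / c)) ^+ 2 * z =
     (h.[u n] / c) * ((c - h^`().[u n]) + (h.[u n] / c) * z) by field.
  rewrite mulrSr; apply: val_geM => //; apply: val_geD.
    by rewrite /c ct -[d]addr0; apply: val_geM; rewrite // val_subC.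
  by rewrite -[d]addr0; apply: val_geM; rewrite //; apply: le_trans he.
have uS n k : ((d *+ n.+1)%:E <= w (u (n + k)%N - u n)%R)%E.
  elim: k => [|k IH]; first by rewrite addn0 subrr val0 leey.
  rewrite addnS /u iterS -/(u _) /phi -/(u n) addrAC; apply: val_geB => //.
  rewrite valM wcV adde0; have [_ _] := inv (n + k)%N; apply: le_trans.
  by rewrite lee_fin ler_pMn2l // ltnS leq_addr.
have [l ul] : exists l, val_cvg w u l.
  apply: wc => M; have [N hN] := rat_arch M d0; exists N => m n.
  wlog mn : m n / (n <= m)%N => [H|].
    by case/orP: (leq_total n m) => ? ? ?; [|rewrite val_subC]; apply: H.
  move=> Nm Nn; rewrite -(subnKC mn); apply: le_trans (uS _ _).
  by rewrite lee_fin; apply: hN; apply: leqW.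
have Bl : B l by apply: cB; apply: cvg_closure ul => n; have [] := inv n.
have lx : (d%:E <= w (l - x)%R)%E.
  have [N /(_ N (leqnn _)) h1] := ul d; apply: (@val_dist _ _ _ _ (u N)).
    by rewrite val_subC.
  by have [] := inv N.
have lx0 : (0 < w (l - x)%R)%E by apply: lt_le_trans lx; rewrite lte_fin.
exists l; split=> //; apply: (@val_ge_all _ w) => M.
have [N1 h1] := rat_arch M d0; have [N2 h2] := ul (Order.max M 0).
have := h2 (maxn N1 N2) (leq_maxr _ _).
rewrite EFin_max ge_max => /andP[h3 h4].
have lO : l \in valring w by apply: (@valring_congr _ w x) => //; rewrite val_subC.
have uO : u (maxn N1 N2) \in valring w by rewrite -(subrK l (u _)) rpredD.
have [z zO] := integral_taylor1 hO uO lO.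
move=> /eqP; rewrite subr_eq addrC -subr_eq => /eqP <-.
apply: val_geB.
  have [_ _] := inv (maxn N1 N2); apply: le_trans; rewrite lee_fin.
  by apply: h1; apply: leqW; apply: leq_maxl.
by rewrite -[M]addr0; apply: val_geM.
Qed.

(** If x is not in W, it keeps a bounded distance from W, so in a convergent
    sequence of elements y + c x the coefficients c form a Cauchy
    sequence; their limit lies in C. *)
Lemma closed_line C W x : is_subfield C -> val_closed w C -> val_closed w W ->
  (forall y z, W y -> W z -> W (y - z)) -> (forall c y, C c -> W y -> W (c * y)) ->
  val_closed w [set y | exists2 c, C c & W (y - c * x)].
Proof.
move=> hC cC cW WB WZ z cz.
have [Wx|nWx] := pselect (W x).
  exists 0; first exact: subfield0.
  rewrite mul0r subr0; apply: cW; apply: closure_mono cz => y [c Cc Wy].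
  have W0 : W 0 by rewrite -(subrr x); apply: WB.
  have := WB _ _ Wy (WZ (- 1) (c * x) _ (WZ _ _ Cc Wx)).
  by rewrite mulN1r opprK subrK; apply; rewrite -sub0r; apply: subfieldB;
    [|apply: subfield0|apply: subfield1].
have [N hN] : exists N : rat, forall y, W y -> ~ (N%:E <= w (x - y)%R)%E.
  apply: contrapT => /forallNP h; apply: nWx; apply: cW => M.
  by have := h M; move/existsNP => [y /not_implyP[Wy /contrapT]]; exists y.
have /choice[f fP] (n : nat) : exists yc : L * L,
    [/\ C yc.2, W (yc.1 - yc.2 * x) & (n%:R%:E <= w (z - yc.1)%R)%E].
  by have [y [c Cc Wy] zy] := cz n%:R; exists (y, c).
pose c n := (f n).2.
(* Divided by c n - c m, the difference of the two approximations of z becomes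
   x - y with y in W, of value less than N. *)
have cdist (M : rat) n m : (M%:E <= w (z - (f n).1)%R)%E ->
    (M%:E <= w (z - (f m).1)%R)%E -> ((M - N)%:E <= w (c n - c m)%R)%E.
  move=> hn hm; have [->|cnm] := eqVneq (c n) (c m); first by rewrite subrr val0 leey.
  rewrite -subr_eq0 in cnm; have [r wr] := val_finE w cnm.
  have [[Cn Wn _] [Cm Wm _]] := (fP n, fP m).
  have Cnm : C (c n - c m) by apply: subfieldB.
  have := hN _ (WZ _ _ (subfieldV hC Cnm) (WB _ _ Wm Wn)).
  set t := (X in w X) => ht.
  have tE : t * (c n - c m) = (f n).1 - (f m).1.
    by rewrite /t -/(c n) -/(c m); field.
  rewrite wr leNgt; apply/negP; rewrite lte_fin => rMN; apply: ht.
  have : (M%:E <= w (t * (c n - c m))%R)%E.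
    by rewrite tE; apply: (val_dist (y := z)) => //; rewrite val_subC.
  rewrite valM wr; case: (w t) => [a| |]; rewrite ?leey //=.
  by rewrite -EFinD !lee_fin; lra.
have [l cl] : exists l, val_cvg w c l.
  apply: wc => M; have [K hK] := rat_arch (M + N) (ltr01 : 0 < 1 :> rat).
  exists K => m n Km Kn; rewrite -[M](addrK N); apply: cdist.
    by have [_ _] := fP m; apply: le_trans; rewrite lee_fin; apply: hK.
  by have [_ _] := fP n; apply: le_trans; rewrite lee_fin; apply: hK.
exists l; first by apply: cC; apply: cvg_closure cl => n; have [] := fP n.
apply: cW => M; have [s sx] := val_lb w x.
have [K1 h1] := rat_arch M (ltr01 : 0 < 1 :> rat).
have [K2 h2] := cl (M - s); pose n := maxn K1 K2.
have [Cn Wn zn] := fP n; exists ((f n).1 - (f n).2 * x) => //.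
have -> : z - l * x - ((f n).1 - (f n).2 * x) = (z - (f n).1) + (c n - l) * x.
  by rewrite /c; ring.
apply: val_geD.
  by apply: le_trans zn; rewrite lee_fin; apply: h1; apply: leq_maxl.
by rewrite -[M](subrK s); apply: val_geM => //; apply: h2; apply: leq_maxr.
Qed.

(** Adding one generator at a time keeps the span closed, by [closed_line]. *)
Lemma closed_span C n (b : 'I_n -> L) : is_subfield C -> val_closed w C ->
  val_closed w [set \sum_i c i * b i | c in [set c | forall i, C (c i)]].
Proof.
move=> hC cC; elim: n b => [|n IH] b.
  move=> z cz; exists (fun=> 0); first by move=> i; apply: subfield0.
  rewrite big_ord0; apply/esym/(@val_ge_all _ w) => M; have [_ [c _ <-]] := cz M.
  by rewrite big_ord0 subr0.
pose b' (i : 'I_n) := b (widen_ord (leqnSn n) i).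
set W := [set \sum_i c i * b' i | c in [set c | forall i, C (c i)]].
have -> : [set \sum_i c i * b i | c in [set c | forall i, C (c i)]] =
          [set y | exists2 c, C c & W (y - c * b ord_max)].
  apply/seteqP; split=> [_ [c Cc <-]|y [c Cc [c' Cc' yE]]].
    exists (c ord_max) => //; exists (fun i => c (widen_ord (leqnSn n) i)) => //.
    by rewrite big_ord_recr /= addrK.
  exists (fun i : 'I_n.+1 => oapp c' c (insub (val i))).
    by move=> i /=; case: insub.
  rewrite big_ord_recr /= insubF ?ltnn //= -[RHS](subrK (c * b ord_max)) -yE.
  by congr (_ + _); apply: eq_bigr => i _; rewrite valK.
apply: closed_line => //; first exact: IH.
- move=> _ _ [c Cc <-] [e Ce <-]; exists (fun i => c i - e i).
    by move=> i; apply: subfieldB.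
  by rewrite -sumrB; apply: eq_bigr => i _; rewrite mulrBl.
- move=> a _ Ca [c Cc <-]; exists (fun i => a * c i); first by move=> i; apply: subfieldM.
  by rewrite mulr_sumr; apply: eq_bigr => i _; rewrite mulrA.
Qed.

End Complete.

(** * Lifted minimal polynomials of residues *)

Section Residual.
Context (L : fieldType) (w : valuation L).
Implicit Types (x y z : L) (A B C W : set L) (p h : {poly L}).

Definition integral_in B p := coefs_in B p /\ p \is a polyOver (valring w).

(** This expresses, without mention of the residue field, that h is monic
    and integral over B and reduces to the minimal polynomial of the
    residue of x over the residue field of B. *)
Definition residue_minpoly B x h :=
  [/\ h \is monic, integral_in B h, (0 < w h.[x])%E &
      forall p, integral_in B p -> (size p < size h)%N -> (0 < w p.[x])%E ->
        forall i, (0 < w p`_i)%E].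

(** Divide by a coefficient of least value. *)
Lemma primitive_part B p : is_subfield B -> coefs_in B p -> p != 0 ->
  exists c q, [/\ B c, c != 0, p = c *: q, integral_in B q & exists i, w q`_i = 0%E].
Proof.
move=> hB Bp p0; have szp : (0 < size p)%N by rewrite size_poly_gt0.
have lp : ((size p).-1 < size p)%N by rewrite prednK.
pose F (i : 'I_(size p)) := w p`_i.
have [i _ imin] := @arg_minP _ _ _ (Ordinal lp) predT F isT.
have c0 : p`_i != 0.
  apply: contraTneq (imin (Ordinal lp) isT) => pi0; rewrite /F pi0 val0 leye_eq /=.
  by apply/eqP => /val_eqy/eqP; rewrite -/(lead_coef p) lead_coef_eq0 (negPf p0).
exists p`_i, ((p`_i)^-1 *: p); split=> //.
- by rewrite scalerA divff // scale1r.
- split; first by apply: coefs_inZ => //; apply: subfieldV.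
  apply/polyOverP => j; rewrite coefZ valringE.
  have [jp|jp] := ltnP j (size p); last by rewrite (nth_default _ jp) mulr0 val0 leey.
  have [r wr] := val_finE w c0; have := imin (Ordinal jp) isT.
  rewrite /F /= wr valM (valV wr); case: (w p`_j) => [s| |] //=.
  by rewrite !lee_fin; lra.
- exists i; rewrite coefZ mulVf //; exact: val1.
Qed.

Lemma integral_in_monic_coef p : p \is monic -> w p`_(size p).-1 = 0%E.
Proof. by move=> /monicP; rewrite /lead_coef => ->; rewrite val1. Qed.

(** An integral polynomial of least degree, not reducing to zero, that is
    small at x has a unit as leading coefficient: otherwise dropping the
    leading term would lower the degree. *)
Lemma residue_minpoly_exists B x p : is_subfield B -> x \in valring w ->
  integral_in B p -> (0 < w p.[x])%E -> (exists i, w p`_i = 0%E) ->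
  exists h, residue_minpoly B x h.
Proof.
move=> hB xO Bp px pu.
pose Q n := `[< exists q, [/\ integral_in B q, (0 < w q.[x])%E,
  exists i, w q`_i = 0%E & size q = n] >].
have exQ : exists n, Q n by exists (size p); apply/asboolP; exists p.
case: (ex_minnP exQ) => n /asboolP[{px pu Bp}p [[Bp pO] px [i pi] szp] minn].
have lemin q : integral_in B q -> (size q < n)%N -> (0 < w q.[x])%E ->
    forall j, (0 < w q`_j)%E.
  move=> Bq qn qx j; apply: contrapT => wq.
  have /minn : Q (size q); last by rewrite leqNgt qn.
  apply/asboolP; exists q; split=> //; exists j; apply: val_unitP wq.
  by apply/polyOverP; case: Bq.
have p0 : p != 0.
  by apply/negP => /eqP p0; move: pi; rewrite p0 coef0 val0.
have szp0 : (0 < size p)%N by rewrite size_poly_gt0.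
have lead : w (lead_coef p) = 0%E.
  apply: (@val_unitP _ w) => [|wl]; first by apply/polyOverP.
  pose q := \poly_(j < (size p).-1) p`_j.
  have qp : p = q + lead_coef p *: 'X^((size p).-1).
    apply/polyP => j; rewrite coefD coefZ coefXn coef_poly.
    case: ltngtP => [_|ji|->]; rewrite ?mulr0 ?addr0 ?mulr1 ?add0r //.
    by rewrite nth_default // -(prednK szp0).
  have Bq : integral_in B q.
    split; last by apply/polyOver_poly => j _; apply/polyOverP.
    by move=> j; rewrite coef_poly; case: ifP => // _; apply: subfield0.
  have qn : (size q < n)%N.
    by rewrite -szp; apply: leq_ltn_trans (size_poly _ _) _; rewrite prednK.
  have qx : (0 < w q.[x])%E.
    have -> : q = p - lead_coef p *: 'X^((size p).-1).
      by apply/eqP; rewrite eq_sym subr_eq -qp.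
    rewrite hornerD hornerN hornerZ hornerXn; apply: val_gtB => //.
    by rewrite mulrC; apply: val_posM; rewrite // rpredX.
  have := lemin q Bq qn qx i; rewrite coef_poly; case: ltnP => [|ip].
    by rewrite pi ltxx.
  move: pi wl; have [->|ni] := eqVneq i (size p).-1.
    by rewrite /lead_coef => ->; rewrite ltxx.
  rewrite nth_default ?val0 //; move: ip ni; rewrite leq_eqVlt eq_sym => /orP[->//|].
  by rewrite -ltnS prednK.
have lV : w (lead_coef p)^-1 = 0%E by have := valV lead; rewrite oppr0.
exists ((lead_coef p)^-1 *: p); split.
- by rewrite monicE lead_coefZ mulVf // lead_coef_eq0.
- split; first by apply: coefs_inZ => //; apply: subfieldV => //; apply: Bp.
  by apply: polyOverZ => //; apply: val0_int.
- by rewrite hornerZ valM lV add0e.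
- by rewrite size_scale ?szp ?invr_eq0 ?lead_coef_eq0.
Qed.

(** Up to a constant c of B the polynomial p is primitive; then its value at
    x is a unit by minimality, and so is its value at u, which has the
    same residue. *)
Lemma residue_minpoly_value B x h u p : is_subfield B -> x \in valring w ->
  residue_minpoly B x h -> (0 < w (x - u)%R)%E ->
  coefs_in B p -> p != 0 -> (size p < size h)%N ->
  exists c, [/\ B c, c != 0 & w p.[u] = w c].
Proof.
move=> hB xO [_ _ _ hmin] xu Bp p0 szp.
have [c [q [Bc c0 pE Bq [i qi]]]] := primitive_part hB Bp p0.
exists c; split=> //; rewrite pE hornerZ valM.
suff -> : w q.[u] = 0%E by rewrite adde0.
have qO := Bq.2; have uO := valring_congr xO xu.
have szq : (size q < size h)%N by move: szp; rewrite pE size_scale.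
apply: (@val_congr0 _ w q.[x]); last exact: val_horner_congr.
apply: (@val_unitP _ w) => [|qx]; first exact: rpred_horner.
by have := hmin q Bq szq qx i; rewrite qi ltxx.
Qed.

(** Adjoining a root of the lifted minimal polynomial extends the residue
    field but creates no new value. *)
Lemma adjoin_discrete B x h u d : is_subfield B -> x \in valring w ->
  residue_minpoly B x h -> (0 < w (x - u)%R)%E -> root h u ->
  discrete w d B -> discrete w d (adjoin B u).
Proof.
move=> hB xO hx xu hu dB y.
have [hm [Bh _] _ _] := hx; have h0 := monic_neq0 hm.
rewrite (adjoinE hB h0 Bh hu) => -[p [Bp szp] <-] pu0.
have p0 : p != 0 by apply: contraNneq pu0 => ->; rewrite horner0.
have [c [Bc c0 ->]] := residue_minpoly_value hB xO hx xu Bp p0 szp.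
exact: dB.
Qed.

Lemma integral_in_divmod B h G : is_subfield B -> h \is monic ->
  integral_in B h -> integral_in B G ->
  exists q r, [/\ integral_in B q, integral_in B r, G = q * h + r &
                  (size r < size h)%N].
Proof.
move=> hB hm [Bh hO]; have [n] := ubnP (size G); elim: n G => // n IH G.
have szh : (0 < size h)%N by rewrite size_poly_gt0 monic_neq0.
rewrite ltnS => szG [BG GO]; have [Gh|hG] := ltnP (size G) (size h).
  exists 0, G; split=> //; last by rewrite mul0r add0r.
  by split; [move=> i; rewrite coef0; apply: subfield0|apply: rpred0].
pose k := (size G - size h)%N; pose m := lead_coef G *: 'X^k.
have Bm : integral_in B m.
  split=> [|]; first apply: coefs_inZ => //; first exact: BG.
    by move=> i; rewrite coefXn; case: eqP => _; [apply: subfield1|apply: subfield0].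
  by apply: polyOverZ; [apply/polyOverP|apply: rpredX; apply: polyOverX].
have szG1 : (size (G - m * h)%R < n)%N.
  apply: leq_trans szG; rewrite -(prednK (leq_trans szh hG)) ltnS.
  apply/leq_sizeP => j jG; rewrite coefB /m -scalerAl coefZ coefXnM.
  have kj : (k <= j)%N by apply: leq_trans jG; rewrite /k -subn1; apply: leq_sub2l.
  rewrite ltnNge kj /=; move: jG; rewrite leq_eqVlt => /orP[/eqP<-|jG].
    have -> : ((size G).-1 - k = (size h).-1)%N.
      by rewrite /k; move: szh hG; move: (size h) (size G) => a b; lia.
    by rewrite -!/(lead_coef _) (monicP hm) mulr1 subrr.
  rewrite !nth_default ?mulr0 ?subrr // /k; move: szh hG jG;
    by move: (size h) (size G) => a b; lia.
have BG1 : integral_in B (G - m * h).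
  split; last by rewrite rpredB ?rpredM ?Bm.2.
  move=> i; rewrite coefB; apply: subfieldB => //.
  by apply: coefs_inM => //; case: Bm.
have [q [r [[Bq qO] Br GE szr]]] := IH _ szG1 BG1.
exists (q + m), r; split=> //.
  by split; [apply: coefs_inD => //; case: Bm|rewrite rpredD ?Bm.2].
by rewrite mulrDl addrAC -GE subrK.
Qed.

(** Modulo the maximal ideal h divides G, because the remainder of the
    division is small at x and of lower degree than h, hence reduces to
    zero. So G = q h gives G'(x) = q(x) h'(x) on residues, and h'(x) is
    a unit along with G'(x). *)
Lemma residue_minpoly_separable B x h G : is_subfield B -> x \in valring w ->
  residue_minpoly B x h -> integral_in B G ->
  (0 < w G.[x])%E -> w G^`().[x] = 0%E -> w h^`().[x] = 0%E.
Proof.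
move=> hB xO [hm Bh hx hmin] BG Gx G'x.
have [q [r [[_ qO] Br GE szr]]] := integral_in_divmod hB hm Bh BG.
have [hO rO] := (Bh.2, Br.2).
have rx : (0 < w r.[x])%E.
  have -> : r.[x] = G.[x] - q.[x] * h.[x] by rewrite GE hornerD hornerM addrC addKr.
  by apply: val_gtB => //; apply: val_posM; rewrite // rpred_horner.
have rm := hmin r Br szr rx.
apply: (@val_unitP _ w) => [|h'x].
  by apply: rpred_horner => //; apply: polyOver_deriv.
have : (0 < w G^`().[x])%E; last by rewrite G'x ltxx.
rewrite GE derivD derivM !hornerD !hornerM; apply: val_gtD.
  apply: val_gtD; apply: val_posM; rewrite // rpred_horner //.
  exact: polyOver_deriv.
apply: val_pos_horner => // i; rewrite coef_deriv -mulr_natl.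
by apply: val_posM; rewrite // rpred_nat.
Qed.

(** Otherwise the term of least value would be the only one of its value,
    and the sum would have that same finite value. *)
Lemma sum0_equal_values m (F : 'I_m -> L) : \sum_i F i = 0 ->
  (exists i, F i != 0) -> exists i j : 'I_m, [/\ (i < j)%N, F i != 0 & w (F i) = w (F j)].
Proof.
move=> F0 [i0 Fi0].
have [i _ imin] := @arg_minP _ _ _ i0 predT (fun i => w (F i)) isT.
have Fi : F i != 0.
  apply: contraTneq (imin i0 isT) => pi0; rewrite pi0 val0 leye_eq /=.
  by apply/eqP => /val_eqy/eqP; rewrite (negPf Fi0).
have [j ij Fij] : exists2 j, j != i & w (F i) = w (F j).
  apply: contrapT => h; have : (w (F i) < w (\sum_(j | j != i) F j)%R)%E.
    have [r wr] := val_finE w Fi.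
    apply: val_pos_sum => [|j ji]; first by rewrite wr ltry.
    rewrite lt_neqAle imin // andbT; apply/eqP => e; apply: h.
    by exists j.
  move: F0; rewrite (bigD1 i) //= addrC => /eqP; rewrite addr_eq0 => /eqP ->.
  by rewrite valN ltxx.
have Fj : F j != 0 by rewrite -(val_fin_num w) -Fij val_fin_num.
case: (ltngtP i j) => [lij|lij|/val_inj e].
- by exists i, j.
- by exists j, i.
- by rewrite e eqxx in ij.
Qed.

(** An algebraic relation of degree at most n satisfied by y has two terms
    of equal value, so that (j - i) w(y) lies in d Z for some 0 < j - i
    <= n; the factorial n! is a common denominator for all y. *)
Lemma algebraic_discrete C a d : is_subfield C -> discrete w d C ->
  algebraic_over C a ->
  exists2 N : nat, (0 < N)%N & discrete w (d / N%:R) (adjoin C a).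
Proof.
move=> hC dC alg; have [_ hE _ [n [b EE]]] := adjoin_finite hC alg.
exists n`!; first exact: fact_gt0.
move=> y Ey y0; have [s ys] := val_finE w y0.
have [|p [p0 Cp py szp]] := @span_algebraic _ _ hC n b y.
  move=> k; have : adjoin C a (y ^+ k) by apply: (subfieldX hE).
  by rewrite EE => -[c Cc <-]; exists c.
have [||i [j [ij pi pij]]] := @sum0_equal_values _ (fun i : 'I_(size p) => p`_i * y ^+ i).
- by rewrite -horner_coef (eqP py).
- have lp : ((size p).-1 < size p)%N by rewrite prednK ?size_poly_gt0.
  by exists (Ordinal lp); rewrite mulf_neq0 ?expf_neq0 // -/(lead_coef p) lead_coef_eq0.
have pj : p`_j * y ^+ j != 0 by rewrite -(val_fin_num w) -pij val_fin_num.
move: pi pj; rewrite !mulf_eq0 !negb_or => /andP[pi _] /andP[pj _].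
have [[k wk] [l wl]] := (dC _ (Cp i) pi, dC _ (Cp j) pj).
move: pij; rewrite !valM !(valX _ ys) wk wl -!EFinD => -[e].
have jin : (j - i <= n)%N.
  by rewrite leq_subLR; apply: leq_trans (leq_addl _ _); rewrite -ltnS; apply: leq_trans szp.
have dvd : (j - i %| n`!)%N by apply: dvdn_fact; rewrite subn_gt0 ij.
exists ((k - l) * (n`! %/ (j - i))%N%:Z); rewrite ys; congr (_%:E).
have ji0 : ((j - i)%N%:R : rat) != 0 by rewrite pnatr_eq0 -lt0n subn_gt0.
have f0 : (n`!%:R : rat) != 0 by rewrite pnatr_eq0 -lt0n fact_gt0.
have sE : s * (j - i)%N%:R = d *~ (k - l).
  rewrite mulr_natr mulrnBr 1?ltnW // mulrzBr.
  by move: e; move: (d *~ k) (d *~ l) (s *+ i) (s *+ j) => *; lra.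
apply: (mulIf ji0); rewrite sE -mulrzr -[in RHS]mulrzr intrM.
have -> : ((n`! %/ (j - i))%N%:~R : rat) = n`!%:R / (j - i)%N%:R.
  by rewrite -[LHS]/((n`! %/ (j - i))%N%:R) natr_div // unitfE.
by field; rewrite ji0 f0.
Qed.

End Residual.

(** * Discrete fields with full residue field *)

Section MaximalUnramified.
Context (L : fieldType) (w : valuation L) (wc : val_complete w).
Implicit Types (x y z : L) (A B C E : set L) (p h : {poly L}).

(** The residue field of B is the whole residue field. *)
Definition residually_dense B :=
  forall x, x \in valring w -> exists2 b, B b & (0 < w (x - b)%R)%E.

(** Every residue is a simple root of the reduction of an integral
    polynomial over A: the residue field is algebraic and separable over
    that of A. *)
Definition residually_separable A :=
  forall x, x \in valring w -> exists G, [/\ integral_in w A G,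
    exists i, w G`_i = 0%E, (0 < w G.[x])%E & w G^`().[x] = 0%E].

Lemma integral_in_sub A B p : A `<=` B -> integral_in w A p -> integral_in w B p.
Proof. by move=> AB [Ap pO]; split=> // i; apply: AB. Qed.

Lemma chain_subfield (F : set (set L)) : F !=set0 ->
  (forall X, F X -> is_subfield X) -> total_on F subset ->
  is_subfield (\bigcup_(X in F) X).
Proof.
move=> [X0 FX0] hF tot.
have both x y : (\bigcup_(X in F) X) x -> (\bigcup_(X in F) X) y ->
    exists Z, [/\ F Z, Z x & Z y].
  move=> [X FX Xx] [Y FY Yy]; have [XY|YX] := tot _ _ FX FY.
    by exists Y; split=> //; apply: XY.
  by exists X; split=> //; apply: YX.
apply/is_subfieldP; split=> [|x y xU yU|x y xU yU].
- by exists X0 => //; apply: subfield1; apply: hF.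
- have [Z [FZ Zx Zy]] := both x y xU yU.
  by exists Z => //; apply: subfieldB => //; apply: hF.
- have [Z [FZ Zx Zy]] := both x y xU yU.
  by exists Z => //; have /is_subfieldP[_ _] := hF Z FZ; apply.
Qed.

(** Zorn's lemma gives a maximal subfield B above A with values in d Z. It
    is closed, since its closure has the same values. If a residue were
    missing from B, the lift of its minimal polynomial would have a root
    by Hensel's lemma, and adjoining this root would contradict
    maximality. *)
Lemma maximal_discrete A d : is_subfield A -> discrete w d A ->
  residually_separable A ->
  exists B, [/\ is_subfield B, A `<=` B, val_closed w B, discrete w d B
              & residually_dense B].
Proof.
move=> hA dA sepA.
(* The union of the empty chain is empty, hence the extra disjunct set0 below. *)
pose good X := [/\ is_subfield X, A `<=` X & discrete w d X].
have [F FP totF|B [PB maxB]] := @Zorn_bigcup L [set X | X = set0 \/ good X].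
  pose F' := [set X | F X /\ good X].
  have UE : \bigcup_(X in F) X = \bigcup_(X in F') X.
    apply/seteqP; split=> x [X FX Xx]; last by exists X => //; case: FX.
    exists X => //; split=> //; case: (FP X FX) => // X0.
    by move: Xx; rewrite X0.
  have [F0|nF0] := pselect (F' !=set0); last first.
    left; rewrite UE; apply/seteqP; split=> x // [X F'X _].
    by apply: nF0; exists X.
  right; rewrite UE; split.
  - apply: chain_subfield => //; first by move=> X [_ []].
    by move=> X Y [FX _] [FY _]; apply: totF.
  - by have [X F'X] := F0; move=> x Ax; exists X => //; case: F'X => _ [_ AX _]; apply: AX.
  - by move=> x [X [_ [_ _ dX]] Xx]; apply: dX.
have gA : good A by split.
have {PB}[hB AB dB] : good B.
  case: PB => // B0; case: (maxB A); last by right.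
  rewrite B0; split=> // /(_ 1 (subfield1 hA)); exact.
have maxB' X : good X -> B `<=` X -> X `<=` B.
  by move=> gX BX; apply: contrapT => nXB; apply: (maxB X); [split|right].
have cB : val_closed w B.
  apply: maxB'; last exact: sub_closure.
  split; [exact: closure_subfield| |exact: discrete_closure].
  by apply: subset_trans AB _; apply: sub_closure.
exists B; split=> // x xO; apply: contrapT => nx.
have [G [AG Gu Gx G'x]] := sepA x xO.
have BG := integral_in_sub AB AG.
have [h hx] := residue_minpoly_exists hB xO BG Gx Gu.
have h'x := residue_minpoly_separable hB xO hx BG Gx G'x.
have [hm [Bh hO] hx0 _] := hx.
have hT : is_subfield [set: L] by apply/is_subfieldP; split.
have [//|//|//|//|//|//|//|//|u [_ hu ux]] := @hensel _ w wc [set: L] h x.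
apply: nx; exists u; last by rewrite val_subC.
apply: (maxB' (adjoin B u)); last exact: adjoin_gen.
  split; first exact: adjoin_subfield.
    by apply: subset_trans AB _; apply: adjoin_sub.
  by apply: adjoin_discrete hx _ _ dB => //; [rewrite val_subC|apply/rootP].
exact: adjoin_sub.
Qed.

(** Since E has no new values, it suffices to approximate the units of E by
    elements of E and B together. The residue of such a unit is a simple
    root of some G over A; Hensel's lemma lifts it to a root of G in E
    and to a root of G in B, and the two roots coincide because a simple
    root is determined by its residue. *)
Lemma unramified_sub A E B d : 0 < d -> is_subfield A -> discrete w d A ->
  residually_separable A ->
  is_subfield E -> val_closed w E -> A `<=` E ->
  (forall y, E y -> y != 0 -> exists2 c, A c & w c = w y) ->
  is_subfield B -> val_closed w B -> A `<=` B -> residually_dense B ->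
  E `<=` B.
Proof.
move=> d0 hA dA sepA hE cE AE valE hB cB AB dB.
have dE : discrete w d E.
  move=> y Ey y0; have [c Ac wc'] := valE y Ey y0; rewrite -wc'; apply: dA => //.
  by rewrite -(val_fin_num w) wc' val_fin_num.
suff : E `<=` val_closure w (E `&` B).
  move=> h y /h yEB; have [] // := closed_preimage cE cB yEB.
apply: (closure_dense_leading d0 dE) => [y []//|x y|||]; first exact: subfieldB.
- by split; apply: subfield0.
- by move=> x y [Ex Bx] [Ey By]; split; apply: subfieldD.
move=> y Ey y0; have [c Ac wcy] := valE y Ey y0.
have c0 : c != 0 by rewrite -(val_fin_num w) wcy val_fin_num.
set x := y / c.
have x0 : w x = 0%E by apply: val_unit_div.
have Ex : E x by apply: subfieldM => //; apply: subfieldV => //; apply: AE.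
have xO := val0_int x0.
have [G [AG _ Gx G'x]] := sepA x xO.
have [EG BG] := (integral_in_sub AE AG, integral_in_sub AB AG).
have [b Bb xb] := dB x xO; have bO := valring_congr xO xb.
have GO := EG.2.
have G'O : G^`() \is a polyOver (valring w) by apply: polyOver_deriv.
have Gb : (0 < w G.[b])%E.
  rewrite -[G.[b]](subrK G.[x]); apply: val_gtD => //.
  by rewrite val_subC; apply: val_horner_congr.
have G'b : w G^`().[b] = 0%E.
  by apply: (val_congr0 G'x); apply: val_horner_congr.
have [u [Eu Gu ux]] := hensel wc hE cE GO EG.1 xO Ex Gx G'x.
have [u' [Bu' Gu' u'b]] := hensel wc hB cB GO BG.1 bO Bb Gb G'b.
have uO : u \in valring w by apply: (valring_congr xO); rewrite val_subC.
have G'u : w G^`().[u] = 0%E.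
  apply: (val_congr0 G'x); apply: val_horner_congr => //.
  by rewrite val_subC.
have u'x : (0 < w (u' - x)%R)%E.
  by apply: (val_dist_gt u'b); rewrite val_subC.
(* Both roots have the residue of x, where G has a simple root. *)
have uu' : u = u'.
  apply: (simple_root_unique GO uO _ G'u Gu Gu').
  by apply: (val_dist_gt u'x); rewrite val_subC.
exists (c * u).
  by split; apply: subfieldM => //; [apply: AE|apply: AB|rewrite uu'].
have -> : y - c * u = c * (x - u) by rewrite /x mulrBr mulrCA divff // mulr1.
rewrite valM wcy val_subC; have [r ->] := val_finE w y0.
by rewrite -[X in (X < _)%E]adde0 lteD2lE.
Qed.

(** Choose one element of E for each class of values modulo d Z that occurs.
    Every nonzero element of E has the value of some p ^ q * b r, and a
    coefficient in C adjusts the residue; successive approximation shows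
    that the C-span of the b r, which is closed, is all of E. *)
Lemma discrete_finite C E d N : (0 < N)%N -> 0 < d ->
  is_subfield C -> val_closed w C -> residually_dense C ->
  (exists2 p, C p & w p = d%:E) ->
  is_subfield E -> C `<=` E -> discrete w (d / N%:R) E ->
  finite_extension C E.
Proof.
move=> N0 d0 hC cC fC [p Cp wp] hE CE dE; split=> //.
have /choice[b bP] (r : 'I_N) : exists b, E b /\
    forall y, E y -> w y = (d / N%:R *~ r)%:E -> w b = w y.
  have [[b [Eb wb]]|nb] := pselect (exists b, E b /\ w b = (d / N%:R *~ r)%:E).
    by exists b; split=> // y _ ->.
  (* This class of values does not occur in E; any element will do. *)
  exists 0; split; first exact: subfield0.
  by move=> y Ey wy; case: nb; exists y.
exists N, b; set D := [set _ | _ in _]; apply/seteqP; split; last first.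
  by move=> _ [c Cc <-]; apply: subfield_sum => // i _; apply: subfieldM => //;
    [apply: CE|case: (bP i)].
have cD : val_closed w D by apply: closed_span.
apply: subset_trans cD; have N0R : (0 : rat) < N%:R by rewrite ltr0n.
apply: (closure_dense_leading (divr_gt0 d0 N0R) dE) => [|x y||x y|].
- by move=> _ [c Cc <-]; apply: subfield_sum => // i _; apply: subfieldM => //;
    [apply: CE|case: (bP i)].
- exact: subfieldB.
- exists (fun=> 0); first by move=> i; apply: subfield0.
  by rewrite big1 // => i _; rewrite mul0r.
- move=> [c Cc <-] [e Ce <-]; exists (fun i => c i + e i).
    by move=> i; apply: subfieldD.
  by rewrite -big_split; apply: eq_bigr => i _; rewrite mulrDl.
move=> y Ey y0; have [m wy] := dE y Ey y0.
have rN : (`|(m %% N)%Z| < N)%N.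
  by rewrite -ltz_nat gez0_abs ?modz_ge0 ?ltz_pmod // ?eqz_nat -?lt0n // ltz_nat.
pose r := Ordinal rN; pose q := (m %/ N)%Z.
have p0 : p != 0 by rewrite -(val_fin_num w) wp.
have wpq : w (p ^ q) = (d *~ q)%:E.
  have wpn (n : nat) : w (p ^+ n) = (d *+ n)%:E by apply: valX.
  case: q => n; first exact: wpn.
  by rewrite NegzE -exprnN (valV (wpn _)) mulrNz.
have pq0 : p ^ q != 0 by rewrite expfz_neq0.
have Cpq : C (p ^ q) by apply: subfieldXz.
have wz : w (y / p ^ q) = (d / N%:R *~ r)%:E.
  rewrite valM wy (valV wpq) -EFinD; congr (_%:E).
  rewrite /r /= -[in LHS]mulrzr -[d *~ q]mulrzr -[in RHS]mulrzr.
  rewrite gez0_abs ?modz_ge0 ?eqz_nat -?lt0n //.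
  rewrite {1}(divz_eq m N) -/q intrD intrM.
  have -> : (N%:~R : rat) = N%:R by [].
  by field; rewrite gt_eqF.
have [Er wr] := bP r.
have Ez : E (y / p ^ q) by apply: subfieldM => //; apply: subfieldV => //; apply: CE.
have wbz := wr _ Ez wz.
have z0 : y / p ^ q != 0 by rewrite mulf_neq0 ?invr_eq0.
have br0 : b r != 0 by rewrite -(val_fin_num w) wbz val_fin_num.
(* z and b r have the same value; c matches the residue of their quotient. *)
set z := y / p ^ q in wz Ez wbz z0 *.
have t0 : w (z / b r) = 0%E by apply: val_unit_div.
have [c Cc tc] := fC _ (val0_int t0).
exists (p ^ q * c * b r).
  exists (fun i => if i == r then p ^ q * c else 0).
    by move=> i /=; case: ifP => _; [apply: subfieldM|apply: subfield0].
  rewrite (bigD1 r) //= eqxx big1 ?addr0 // => i /negPf->.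
  by rewrite mul0r.
have -> : y - p ^ q * c * b r = y * (1 - c * (b r / z)).
  by rewrite /z; field; rewrite pq0 y0.
rewrite valM; have [s ws] := val_finE w y0; rewrite ws.
rewrite -[X in (X < _)%E]adde0 lteD2lE //.
have -> : 1 - c * (b r / z) = (z / b r - c) * (b r / z) by field; rewrite br0 z0.
by rewrite valM (val_unit_div br0 wbz) adde0.
Qed.

End MaximalUnramified.

(** * Reduction of polynomials and separability *)

Section Residue.
Context (L : fieldType) (w : valuation L).
Implicit Types (x y z : L).

Lemma residueE (a : valring_of w) :
  residue w (val a) = \pi_{ideal_quot maxideal w} a.
Proof. by rewrite /residue valKd. Qed.

Lemma valring_sub x : x \in valring w -> exists a : valring_of w, val a = x.
Proof. by move=> xO; exists (Sub x xO); rewrite SubK. Qed.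

Lemma residueD x y : x \in valring w -> y \in valring w ->
  residue w (x + y) = residue w x + residue w y.
Proof.
by move=> /valring_sub[a <-] /valring_sub[b <-]; rewrite -rmorphD !residueE rmorphD.
Qed.

Lemma residueM x y : x \in valring w -> y \in valring w ->
  residue w (x * y) = residue w x * residue w y.
Proof.
by move=> /valring_sub[a <-] /valring_sub[b <-]; rewrite -rmorphM !residueE rmorphM.
Qed.

Lemma residueN x : x \in valring w -> residue w (- x) = - residue w x.
Proof. by move=> /valring_sub[a <-]; rewrite -rmorphN !residueE rmorphN. Qed.

Lemma residue1 : residue w 1 = 1.
Proof. by rewrite -[1](rmorph1 (\val : valring_of w -> L)) residueE rmorph1. Qed.

Lemma residue_eq0 x : x \in valring w -> (residue w x == 0) = (0 < w x)%E.
Proof. by move=> /valring_sub[a <-]; rewrite residueE residue_pi_eq0. Qed.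

Lemma residue_eq x y : x \in valring w -> y \in valring w ->
  (residue w x = residue w y) <-> (0 < w (x - y)%R)%E.
Proof.
move=> xO yO; rewrite -residue_eq0 ?rpredB // residueD ?rpredN // residueN //.
by rewrite subr_eq0; split=> /eqP.
Qed.

Lemma residue_surj (q : residue_field w) : exists2 x, x \in valring w & residue w x = q.
Proof.
exists (val (repr (q : {ideal_quot maxideal w}))); first exact: valP.
by rewrite residueE reprK.
Qed.
End Residue.

Section ResidueMorphism.
Context (F L : fieldType) (v : valuation F) (w : valuation L).
Context (i : {rmorphism F -> L}) (iE : extends_val v w i).

(** The compatibility proof is an argument so that canonical instances can be
    attached to these maps: only compatible embeddings preserve integrality. *)
Definition incl_of of extends_val v w i := fun a : valring_of v => i (val a).
Definition red_of of extends_val v w i :=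
  fun a : valring_of v => residue w (i (val a)).
Local Notation incl := (incl_of iE).
Local Notation red := (red_of iE).

Lemma incl_int a : incl a \in valring w.
Proof. by rewrite valringE /incl iE; apply: (valP a). Qed.

HB.instance Definition _ := GRing.RMorphism.copy incl (i \o (\val : valring_of v -> F)).

Lemma red_zmod : zmod_morphism red.
Proof.
move=> a b; rewrite /red_of !rmorphB residueD ?rpredN ?incl_int //.
by rewrite residueN // incl_int.
Qed.
HB.instance Definition _ := GRing.isZmodMorphism.Build (valring_of v) (residue_field w)
  red red_zmod.

Lemma red_monoid : monoid_morphism red.
Proof.
split; first by rewrite /red_of !rmorph1 residue1.
by move=> a b; rewrite /red_of !rmorphM residueM ?incl_int.
Qed.
HB.instance Definition _ := GRing.isMonoidMorphism.Build (valring_of v) (residue_field w)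
  red red_monoid.

Lemma red_eq0 a : (red a == 0) = (0 < v (val a))%E.
Proof. by rewrite /red_of residue_eq0 ?incl_int // iE. Qed.

Lemma incl_pos a : (0 < w (incl a))%E = (0 < v (val a))%E.
Proof. by rewrite /incl_of iE. Qed.

Lemma incl_inj : injective incl.
Proof. by move=> a b /fmorph_inj/val_inj. Qed.

Lemma size_incl P : size (map_poly incl P) = size P.
Proof. by apply: size_map_inj_poly; [apply: incl_inj|rewrite rmorph0]. Qed.

Lemma incl_integral P : integral_in w (range i) (map_poly incl P).
Proof.
split=> [k|]; first by rewrite coef_map; exists (val P`_k).
by apply/polyOverP => k; rewrite coef_map incl_int.
Qed.

Lemma incl_lift p : integral_in w (range i) p -> exists P, map_poly incl P = p.
Proof.
move=> [Fp /polyOverP pO].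
have /choice[f fE] k : exists a, incl a = p`_k.
  have [x _ xE] := Fp k; have xO : x \in valring v.
    by rewrite valringE -iE xE; apply: pO.
  by exists (Sub x xO); rewrite /incl_of SubK.
exists (\poly_(k < size p) f k); apply/polyP => k; rewrite coef_map coef_poly.
case: ltnP => [_|kp]; first exact: fE.
by rewrite [LHS](rmorph0 incl) nth_default.
Qed.

Lemma red_horner P x : x \in valring w ->
  residue w (map_poly incl P).[x] = (map_poly red P).[residue w x].
Proof.
move=> xO; elim/poly_ind: P => [|P c IH].
  by rewrite !rmorph0 !horner0; apply/eqP; rewrite residue_eq0 ?val0 // rpred0.
have PO : (map_poly incl P).[x] \in valring w.
  by apply: rpred_horner => //; case: (incl_integral P).
rewrite !rmorphD !rmorphM /= !map_polyX !map_polyC !hornerE.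
by rewrite residueD ?residueM ?rpredM ?incl_int // IH.
Qed.

End ResidueMorphism.

Lemma extends_val_id (F : fieldType) (v : valuation F) :
  extends_val v v (idfun : {rmorphism F -> F}).
Proof. by []. Qed.

Section SeparableLift.
Context (F L : fieldType) (v : valuation F) (w : valuation L).
Context (i : {rmorphism F -> L}) (iE : extends_val v w i).
Local Notation incl := (incl_of iE).
Local Notation redw := (red_of iE).
Local Notation red := (red_of (@extends_val_id F v)).

Lemma red_lift (q : {poly residue_field v}) :
  exists Q : {poly valring_of v}, map_poly red Q = q /\ size Q = size q.
Proof.
have /choice[f fE] k : exists a, red a = q`_k.
  have [x xO <-] := residue_surj q`_k.
  by exists (Sub x xO); rewrite /red_of /= ?SubK.
exists (\poly_(k < size q) f k).
have E : map_poly red (\poly_(k < size q) f k) = q.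
  apply/polyP => k; rewrite coef_map coef_poly.
  case: ltnP => [_|kq]; first exact: fE.
  by rewrite [LHS](rmorph0 red) nth_default.
split=> //; apply/eqP; rewrite eqn_leq size_poly -{1}E.
exact: size_poly.
Qed.

Lemma red0_pos (P : {poly valring_of v}) : map_poly red P = 0 ->
  forall k, (0 < w (map_poly incl P)`_k)%E.
Proof.
move=> P0 k; rewrite coef_map incl_pos -(red_eq0 (@extends_val_id F v)).
by rewrite -coef_map P0 coef0.
Qed.

Lemma redw0 (P : {poly valring_of v}) : map_poly red P = 0 -> map_poly redw P = 0.
Proof.
move=> P0; apply/polyP => k; rewrite coef_map coef0; apply/eqP.
by rewrite red_eq0 -(incl_pos iE) -coef_map; apply: red0_pos.
Qed.

Lemma pos_red0 (P : {poly valring_of v}) :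
  (forall k, (0 < w (map_poly incl P)`_k)%E) -> map_poly red P = 0.
Proof.
move=> P0; apply/polyP => k; rewrite coef_map coef0; apply/eqP.
by rewrite red_eq0 -(incl_pos iE) -coef_map.
Qed.

(** The reduction of H is irreducible: a proper factorization would lift to
    integral polynomials Q and R of lower degree with Q(x) R(x) small,
    against minimality. Perfectness then makes it coprime to its
    derivative. The Bezout relation, written over the valuation ring,
    can be transported to every extension of the valuation. *)
Lemma residue_minpoly_lift x h : perfect_field (residue_field v) ->
  x \in valring w -> residue_minpoly w (range i) x h ->
  exists H a b, [/\ h = map_poly incl H, H \is monic &
                    map_poly red (a * H + b * H^`()) = 1].
Proof.
move=> perf xO [hm Ih hx hmin]; have [H hE] := incl_lift iE Ih.
have Hm : H \is monic.
  move: hm; rewrite !monicE -hE lead_coef_map_inj ?rmorph0 //; last exact: incl_inj.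
  by rewrite -(rmorph1 incl) (inj_eq (@incl_inj _ _ _ _ _ _)).
set Hb := map_poly red H.
have Hbm : Hb \is monic by apply: monic_map.
have szHb : size Hb = size H.
  by rewrite size_map_poly_id0 // (monicP Hm) rmorph1 oner_eq0.
have szh : size h = size Hb by rewrite szHb -hE size_incl.
(* Minimality of h, read on reductions. *)
have small (T : {poly valring_of v}) : (size T < size Hb)%N ->
    (0 < w (map_poly incl T).[x])%E -> map_poly red T = 0.
  move=> szT Tx; apply: pos_red0; apply: hmin => //; first exact: incl_integral.
  by rewrite size_incl szh.
have PO (T : {poly valring_of v}) : (map_poly incl T).[x] \in valring w.
  by apply: rpred_horner => //; case: (incl_integral iE T).
have irr : irreducible_poly Hb.
  split.
    rewrite -szh ltnNge; apply/negP => /size1_polyC hC.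
    move: hm hx; rewrite hC monicE lead_coefC => /eqP ->.
    by rewrite hornerC val1 ltxx.
  move=> q qs qH; rewrite -dvdp_size_eqp // eqn_leq dvdp_leq ?monic_neq0 //=.
  have [r HE] := dvdpP _ _ qH; rewrite leqNgt; apply/negP => szq.
  have [[Q [QE szQ]] [R [RE szR]]] := (red_lift q, red_lift r).
  have rq0 : r * q != 0 by rewrite -HE monic_neq0.
  have [r0 q0] : r != 0 /\ q != 0.
    by move: rq0; rewrite mulf_eq0 negb_or => /andP.
  have pos : (0 < w (map_poly incl (R * Q)).[x])%E.
    have e : map_poly red (R * Q - H) = 0 by rewrite rmorphB rmorphM /= QE RE -HE subrr.
    rewrite -[R * Q](subrK H) rmorphD hornerD /= hE; apply: val_gtD => //.
    by apply: val_pos_horner => // k; apply: red0_pos.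
  have [Rx|nRx] := pselect (0 < w (map_poly incl R).[x])%E; last first.
    move: pos; rewrite rmorphM hornerM valM (val_unitP (PO R) nRx) add0e => Qx.
    by move/eqP: q0; apply; rewrite -QE; apply: small => //; rewrite szQ.
  have szr : (size r < size Hb)%N.
    have q1 : (1 < size q)%N by rewrite ltn_neqAle eq_sym qs size_poly_gt0.
    rewrite HE size_mul //; move: q1; case: (size q) => [|[|n]] // _.
    by rewrite !addnS /= ltnS leq_addr.
  by move/eqP: r0; apply; rewrite -RE; apply: small => //; rewrite szR.
have /Bezout_eq1_coprimepP[[a b] /= ab] : coprimep Hb Hb^`().
  by have := perf Hb irr; rewrite unlock.
have [[A [AE _]] [B [BE _]]] := (red_lift a, red_lift b).
exists H, A, B; split=> //.
by rewrite rmorphD !rmorphM /= AE BE -deriv_map.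
Qed.

(** At x the relation becomes b(x) H'(x) = 1 on residues. *)
Lemma bezout_derivative (H a b : {poly valring_of v}) x :
  map_poly red (a * H + b * H^`()) = 1 -> x \in valring w ->
  (0 < w (map_poly incl H).[x])%E -> w (map_poly incl H)^`().[x] = 0%E.
Proof.
move=> ab xO Hx.
have PO (T : {poly valring_of v}) : (map_poly incl T).[x] \in valring w.
  by apply: rpred_horner => //; case: (incl_integral iE T).
rewrite deriv_map; apply: (@val_unitP _ w) => // H'x.
have e : map_poly red (a * H + b * H^`() - 1) = 0 by rewrite rmorphB rmorph1 /= ab subrr.
have : (0 < w (map_poly incl (a * H + b * H^`() - 1)).[x])%E.
  by apply: val_pos_horner => // k; apply: red0_pos.
rewrite rmorphB rmorph1 rmorphD !rmorphM !hornerE => pos.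
have : (0 < w 1%R)%E; last by rewrite val1 ltxx.
rewrite -(subKr ((map_poly incl a).[x] * (map_poly incl H).[x] +
     (map_poly incl b).[x] * (map_poly incl H^`()).[x]) 1).
by apply: val_gtB => //; apply: val_gtD; apply: val_posM.
Qed.

Lemma bezout_separable (H a b : {poly valring_of v}) :
  map_poly red (a * H + b * H^`()) = 1 -> separable_poly (map_poly redw H).
Proof.
move=> ab; rewrite unlock; apply/Bezout_eq1_coprimepP.
exists (map_poly redw a, map_poly redw b) => /=.
apply/eqP; rewrite -subr_eq0; apply/eqP.
rewrite deriv_map -!rmorphM -rmorphD -(rmorph1 (map_poly redw)) -rmorphB /=.
by apply: redw0; rewrite rmorphB rmorph1 /= ab subrr.
Qed.

End SeparableLift.

(** * Unramified lifts in the algebraic closure *)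

Lemma range_subfield (F L : fieldType) (f : {rmorphism F -> L}) : is_subfield (range f).
Proof.
apply/is_subfieldP; split; first by exists 1; rewrite ?rmorph1.
  by move=> _ _ [x _ <-] [y _ <-]; exists (x - y); rewrite ?rmorphB.
by move=> _ _ [x _ <-] [y _ <-]; exists (x / y); rewrite ?fmorph_div.
Qed.

Lemma subgroup_index_self (H : set rat) : H 0 ->
  (forall x y, H x -> H y -> H (x + y)) -> (forall x y, H x -> H y -> H (x - y)) ->
  subgroup_index H H = Some 1%N.
Proof.
move=> H0 HD HB; rewrite /subgroup_index.
have -> : [set [set g + h | h in H] | g in H] = [set H].
  apply/seteqP; split=> [_ [g Hg <-]|_ ->].
    apply/seteqP; split=> [_ [h Hh <-]|h Hh]; first exact: HD.
    by exists (h - g); [apply: HB|rewrite addrC subrK].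
  exists 0 => //; apply/seteqP; split=> [_ [h Hh <-]|h Hh]; first by rewrite add0r.
  by exists h => //; rewrite add0r.
case: asboolP => [_|]; last by case; apply: finite_set1.
by rewrite fset_set1 cardfs1.
Qed.

Lemma value_groupP (L : fieldType) (w : valuation L) (A : set L) : is_subfield A ->
  [/\ value_group w A 0,
      forall x y, value_group w A x -> value_group w A y -> value_group w A (x + y)
    & forall x y, value_group w A x -> value_group w A y -> value_group w A (x - y)].
Proof.
move=> hA; split=> [|x y [a Aa wa] [b Ab wb]|x y [a Aa wa] [b Ab wb]].
- by exists 1; [apply: subfield1|apply: val1].
- by exists (a * b); [apply: subfieldM|rewrite valM wa wb].
- by exists (a / b); [apply: subfieldM => //; apply: subfieldV|rewrite valM wa (valV wb)].
Qed.

Section UnramifiedLift.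
Context (F : fieldType) (v : valuation F) (Khat : fieldType) (vhat : valuation Khat)
  (i : {rmorphism F -> Khat}) (Kbar : closedFieldType) (vbar : valuation Kbar)
  (j : {rmorphism Khat -> Kbar}).
Context (iE : extends_val v vhat i) (idense : val_closure vhat (range i) = setT)
  (jalg : is_algebraic_closure j) (jE : extends_val vhat vbar j)
  (perf : perfect_field (residue_field v)).

Let ji : {rmorphism F -> Kbar} := j \o i.

Lemma jiE : extends_val v vbar ji.
Proof. by move=> x; rewrite /= jE iE. Qed.

Local Notation incl := (incl_of jiE).
Local Notation redbar := (red_of jiE).
Local Notation red := (red_of (@extends_val_id F v)).

Let hj : is_subfield (range j). Proof. exact: range_subfield. Qed.
Let hji : is_subfield (range ji). Proof. exact: range_subfield. Qed.

(** The field F is dense in its completion, so reductions of polynomials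
    over the completion already come from F. *)
Lemma integral_in_approx p : integral_in vbar (range j) p ->
  exists p0, [/\ integral_in vbar (range ji) p0, (size p0 <= size p)%N
               & forall k, (0 < vbar (p`_k - p0`_k)%R)%E].
Proof.
move=> [jp /polyOverP pO].
have /choice[f fP] k : exists a, range ji a /\ (0 < vbar (p`_k - a)%R)%E.
  have [x _ <-] := jp k.
  have [|_ [a _ <-] xa] := @closure_gt _ vhat (range i) x 0 (ltry _).
    by rewrite idense.
  by exists (ji a); split; [exists a|rewrite -rmorphB jE].
exists (\poly_(k < size p) f k); split.
- split=> [k|].
    by rewrite coef_poly; case: ifP => _; [case: (fP k)|apply: subfield0].
  apply/polyOver_poly => k _; have [_ xa] := fP k.
  exact: valring_congr (pO k) xa.
- exact: size_poly.
- move=> k; rewrite coef_poly; case: ltnP => [_|kp]; first by case: (fP k).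
  by rewrite nth_default // subrr val0.
Qed.

(** An equation of y over the completion, made primitive, gives an equation
    for its residue, which density moves to F. There
    [residue_minpoly_lift] applies, and density shows that minimality
    over F is minimality over the completion. *)
Lemma residue_minpoly_separable_lift y : y \in valring vbar ->
  exists H a b, [/\ H \is monic, map_poly red (a * H + b * H^`()) = 1 &
    residue_minpoly vbar (range j) y (map_poly incl H)].
Proof.
move=> yO; have [P P0 Py] := jalg y.
have jP : coefs_in (range j) (map_poly j P) by move=> k; rewrite coef_map; exists P`_k.
have Pj0 : map_poly j P != 0 by rewrite map_poly_eq0.
have [c [q [_ c0 PE jq [k qk]]]] := primitive_part vbar hj jP Pj0.
have qy : q.[y] = 0.
  by move/rootP: Py => /eqP; rewrite PE hornerZ mulf_eq0 (negPf c0) => /eqP.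
have congr p p0 : integral_in vbar (range j) p -> integral_in vbar (range ji) p0 ->
    (forall k, (0 < vbar (p`_k - p0`_k)%R)%E) -> (0 < vbar p.[y])%E -> (0 < vbar p0.[y])%E.
  move=> [_ pO] [_ p0O] pp0 py; rewrite -(subKr p p0) hornerD hornerN.
  by apply: val_gtB => //; apply: val_pos_horner => // l; rewrite coefB.
have [q0 [jq0 _ qq0]] := integral_in_approx jq.
have q0y : (0 < vbar q0.[y])%E by apply: (congr q) => //; rewrite qy val0.
have [|h hy] := residue_minpoly_exists hji yO jq0 q0y.
  by exists k; apply: (val_congr0 qk).
have [H [a [b [hE Hm ab]]]] := residue_minpoly_lift jiE perf yO hy.
exists H, a, b; split=> //; rewrite -hE.
have [hm [jh hO] hy0 hmin] := hy; split=> //.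
  by split=> // l; have [x _ <-] := jh l; exists (i x).
move=> p jp szp py l; have [p0 [jp0 szp0 pp0]] := integral_in_approx jp.
have p0y := congr _ _ jp jp0 pp0 py.
rewrite -(subrK p0`_l p`_l); apply: val_gtD => //; apply: hmin => //.
exact: leq_ltn_trans szp.
Qed.

(** The value of h(y) is the sum of the values of the y - u, over the roots
    u of h, so one of them is positive. *)
Lemma closed_root_near (h : {poly Kbar}) y : h \is monic -> (0 < vbar h.[y])%E ->
  exists2 u, root h u & (0 < vbar (y - u)%R)%E.
Proof.
move=> hm; have [r hE] := closed_field_poly_normal h.
move: hE; rewrite (monicP hm) scale1r => hE.
have rP u : u \in r -> root h u by move=> ur; rewrite hE root_prod_XsubC.
rewrite {1}hE horner_prod; elim: r {hE} rP => [|u r IH] rP.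
  by rewrite big_nil val1 ltxx.
rewrite big_cons valM hornerXsubC => pos.
have [yu|yu] := boolP (0 < vbar (y - u)%R)%E.
  by exists u => //; apply: rP; rewrite mem_head.
apply: IH => [z zr|]; first by apply: rP; rewrite inE zr orbT.
apply: lt_le_trans pos _; rewrite -[leRHS]add0e.
by apply: leeD => //; rewrite leNgt.
Qed.

Lemma residue_subfield_in (A : set Kbar) q : @residue_subfield _ vbar A q <->
  exists x, [/\ A x, x \in valring vbar & residue vbar x = q].
Proof.
by split=> [[x [Ax xO] <-]|[x [Ax xO <-]]]; exists x.
Qed.

(** The reduction of the lifted polynomial H is the minimal polynomial of q,
    and the Bezout relation makes it separable. *)
Lemma residue_separable q : separable_over (@residue_subfield _ vbar (range j)) q.
Proof.
have [y yO yq] := residue_surj q.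
have [H [a [b [Hm ab [hm [jh hO] hy hmin]]]]] := residue_minpoly_separable_lift yO.
exists (map_poly redbar H); last exact: (bezout_separable jiE ab).
have jred x : @residue_subfield _ vbar (range j) (redbar x).
  apply/residue_subfield_in; exists (incl x).
  by split; [exists (i (val x))|apply: incl_int|].
split.
- exact: monic_map.
- by move=> k; rewrite coef_map; apply: jred.
- by apply/rootP; rewrite -yq -red_horner //; apply/eqP; rewrite residue_eq0 // rpred_horner.
move=> p p0 jp py; rewrite leqNgt; apply/negP => szp.
have /choice[f fP] k : exists x, [/\ range j x, x \in valring vbar & residue vbar x = p`_k].
  exact/residue_subfield_in.
pose P := \poly_(k < size p) f k.
have jP : integral_in vbar (range j) P.
  split=> [k|]; last by apply/polyOver_poly => k _; case: (fP k).
  by rewrite coef_poly; case: ifP => _; [case: (fP k)|apply: subfield0].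
have Py : residue vbar P.[y] = p.[q].
  rewrite /P horner_poly [p.[q]]horner_coef -yq.
  have : forall s : seq 'I_(size p),
      \sum_(k <- s) f k * y ^+ k \in valring vbar /\
      residue vbar (\sum_(k <- s) f k * y ^+ k) = \sum_(k <- s) p`_k * residue vbar y ^+ k.
    have yX n : y ^+ n \in valring vbar /\ residue vbar (y ^+ n) = residue vbar y ^+ n.
      elim: n => [|n [yn IH]]; first by rewrite !expr0 rpred1 residue1.
      by rewrite !exprS rpredM // residueM // IH.
    elim=> [|k s [sO IH]].
      rewrite !big_nil rpred0; split=> //.
      by apply/eqP; rewrite residue_eq0 ?val0 // rpred0.
    have [[_ fO fk] [yO' yk]] := (fP k, yX k).
    by rewrite !big_cons rpredD ?rpredM // residueD ?rpredM // residueM // IH fk yk.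
  by case/(_ (index_enum _)).
have szP : (size P < size (map_poly incl H))%N.
  apply: leq_ltn_trans (size_poly _ _) _; rewrite size_incl.
  by apply: leq_trans szp _; apply: size_poly.
have Ppos k : (0 < vbar P`_k)%E.
  have PO : P.[y] \in valring vbar by apply: rpred_horner jP.2 yO.
  have Ppos0 : (0 < vbar P.[y])%E by rewrite -residue_eq0 // Py.
  exact: (hmin P jP szP Ppos0 k).
move/eqP: p0; apply; apply/polyP => k; rewrite coef0.
have [kp|kp] := ltnP k (size p); last by rewrite nth_default.
have [_ fO <-] := fP k; apply/eqP; rewrite residue_eq0 //.
by have := Ppos k; rewrite coef_poly kp.
Qed.

(** A root u of the lifted minimal polynomial H in the residue class of y
    generates an unramified extension: polynomial expressions in u of
    degree less than deg H take the values of constants. *)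
Lemma unramified_near y : y \in valring vbar ->
  exists E u, [/\ unramified vbar (range j) E, E u & (0 < vbar (y - u)%R)%E].
Proof.
move=> yO; have [H [a [b [Hm ab hy]]]] := residue_minpoly_separable_lift yO.
have [hm [jh hO] hy0 _] := hy; have h0 := monic_neq0 hm.
have [u hu yu] := closed_root_near hm hy0.
exists (adjoin (range j) u), u; split=> //; last exact: adjoin_gen.
split.
- by apply: adjoin_finite => //; exists (map_poly incl H).
- have [G0 GD GB] := value_groupP vbar hj.
  rewrite /ramification_index.
  have -> : value_group vbar (adjoin (range j) u) = value_group vbar (range j).
    apply/seteqP; split=> [g [x]|g [x jx xg]]; last by exists x => //; apply: adjoin_sub.
    rewrite (adjoinE hj h0 jh hu) => -[p [jp szp] <-] pg.
    have p0 : p != 0.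
      by apply/negP => /eqP p0; move: pg; rewrite p0 horner0 val0.
    have [c [jc c0 wc]] := residue_minpoly_value hj yO hy yu jp p0 szp.
    by exists c => //; rewrite -wc.
  exact: subgroup_index_self.
- move=> q Eq; exact: residue_separable.
Qed.

End UnramifiedLift.

(** * Finite ramification index as discreteness *)

Section RamificationIndex.
Context (L : fieldType) (w : valuation L).
Implicit Types (A E : set L).

(** With index one, the only coset is the value group of A itself. *)
Lemma ramification_index1 A E : is_subfield A -> is_subfield E ->
  ramification_index w A E = Some 1%N ->
  forall y, E y -> y != 0 -> exists2 c, A c & w c = w y.
Proof.
move=> hA hE; rewrite /ramification_index /subgroup_index.
case: asboolP => // fin [] /eqP/cardfs1P[X XE] y Ey y0.
have [r wy] := val_finE w y0.
have [A0 _ _] := value_groupP w hA; have [E0 _ _] := value_groupP w hE.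
set H := value_group w A in fin XE A0.
have one g : value_group w E g -> [set g + h | h in H] = X.
  move=> Eg; have : [set g + h | h in H] \in
      fset_set [set [set g + h | h in H] | g in value_group w E].
    by rewrite in_fset_set // inE; exists g.
  by rewrite XE inE => /eqP.
have : H r.
  have -> : H = [set 0 + h | h in H].
    by apply/seteqP; split=> [h Hh|_ [h Hh <-]]; [exists h => //|]; rewrite add0r.
  rewrite one // -(one r); last by exists y.
  by exists 0; rewrite ?addr0.
by case=> c Ac wc; exists c; rewrite // wc.
Qed.

(** Every value of E is a rational multiple of g with a denominator common
    to its coset; finitely many cosets have a common denominator N. *)
Lemma ramification_index_discrete A E g : 0 < g -> is_subfield A ->
  discrete w g A -> ramification_index w A E <> None ->
  exists2 N : nat, (0 < N)%N & discrete w (g / N%:R) E.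
Proof.
move=> g0 hA dA; rewrite /ramification_index /subgroup_index.
set H := value_group w A; set G := value_group w E.
case: asboolP => // /finite_fsetP[X XE] _.
have [H0 _ _] := value_groupP w hA.
have frac (n m : nat) x : (0 < n)%N -> (0 < m)%N ->
    (exists k : int, x = g / n%:R *~ k) -> exists k : int, x = g / (n * m)%N%:R *~ k.
  move=> n0 m0 [k ->]; exists (k * m%:Z); rewrite -mulrzr -[RHS]mulrzr intrM natrM.
  by field; rewrite !pnatr_eq0 -!lt0n m0 n0.
have coset c : [set [set x + h | h in H] | x in G] c -> exists2 n : nat, (0 < n)%N &
    forall x, c x -> exists k : int, x = g / n%:R *~ k.
  (* The denominator of x / g serves for the whole coset of x. *)
  move=> [x _ <-]; set q := x / g.
  exists `|denq q|%N; first by rewrite absz_gt0 denq_neq0.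
  move=> _ [h [a Aa wa] <-].
  have den : (`|denq q|%N%:R : rat) = (denq q)%:~R.
    by rewrite -[LHS]/((`|denq q|%N%:Z)%:~R) absz_denq.
  have d0 : ((denq q)%:~R : rat) != 0 by rewrite intr_eq0 denq_neq0.
  have xE : x = g / (denq q)%:~R *~ numq q.
    by rewrite -mulrzr mulrAC -mulrA divq_num_den /q mulrC divfK // gt_eqF.
  have a0 : a != 0 by rewrite -(val_fin_num w) wa.
  have [m] := dA a Aa a0; rewrite wa => -[hE].
  exists (numq q + m * denq q); rewrite mulrzDr den -xE hE; congr (_ + _).
  by rewrite -[RHS]mulrzr intrM -mulrzr; field.
have [N N0 NP] : exists2 N : nat, (0 < N)%N & forall c, c \in (X : seq (set rat)) ->
    forall x, c x -> exists k : int, x = g / N%:R *~ k.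
  have : forall c, c \in (X : seq (set rat)) -> [set [set x + h | h in H] | x in G] c.
    by rewrite XE.
  elim: (X : seq _) => [|c s IH] sP; first by exists 1%N.
  have [|N N0 NP] := IH; first by move=> e es; apply: sP; rewrite inE es orbT.
  have [n n0 nP] := coset c (sP c (mem_head _ _)).
  exists (n * N)%N; first by rewrite muln_gt0 n0.
  move=> e; rewrite inE => /orP[/eqP->|es] x ex; first exact/frac/nP.
  by rewrite mulnC; apply: frac => //; apply: NP ex.
exists N => // y Ey y0; have [r wy] := val_finE w y0.
have [||k rE] := NP [set r + h | h in H] _ r; last by exists k; rewrite wy rE.
  have : [set [set x + h | h in H] | x in G] [set r + h | h in H].
    by exists r => //; exists y.
  by rewrite XE.
- by exists 0; rewrite ?addr0.
Qed.

(** The cosets are represented by the multiples of g / N with multiplier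
    below N. *)
Lemma discrete_ramification_index A E g N : 0 < g -> (0 < N)%N -> is_subfield A ->
  (exists2 p, A p & w p = g%:E) -> discrete w (g / N%:R) E ->
  ramification_index w A E <> None.
Proof.
move=> g0 N0 hA [p Ap wp] dE; rewrite /ramification_index /subgroup_index.
set H := value_group w A; have [H0 HD HB] := value_groupP w hA.
case: asboolP => // nfin _; apply: nfin.
pose c (r : nat) := [set g / N%:R *~ r + h | h in H].
apply: (@sub_finite_set _ _ (c @` `I_N)); last exact/finite_image/finite_II.
move=> _ [x [y Ey wy] <-]; have y0 : y != 0 by rewrite -(val_fin_num w) wy.
have [m] := dE y Ey y0; rewrite wy => -[xE].
have rN : (`|(m %% N)%Z| < N)%N.
  by rewrite -ltz_nat gez0_abs ?modz_ge0 ?ltz_pmod // ?eqz_nat -?lt0n // ltz_nat.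
exists `|(m %% N)%Z|%N => //; rewrite /c.
set s := g / N%:R *~ `|(m %% N)%Z|%N.
have Hxs : H (x - s).
  have -> : x - s = g *~ (m %/ N)%Z.
    rewrite /s gez0_abs ?modz_ge0 ?eqz_nat -?lt0n // xE -mulrzBr.
    rewrite {1}(divz_eq m N) addrK -[LHS]mulrzr intrM -[RHS]mulrzr.
    have -> : (N%:~R : rat) = N%:R by [].
    by field; rewrite pnatr_eq0 -lt0n.
  have gn (n : nat) : H (g *+ n).
    by elim: n => [//|n IH]; rewrite mulrS; apply: HD => //; exists p.
  case: (m %/ N)%Z => n; first exact: gn.
  by rewrite NegzE mulrNz -[- _]add0r; apply: HB => //; apply: gn.
apply/seteqP; split=> [_ [h Hh <-]|_ [h Hh <-]].
  by exists (h - (x - s)); [apply: HB|ring].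
by exists (h + (x - s)); [apply: HD|ring].
Qed.

End RamificationIndex.

(** * The completed unramified closure *)

Section CompletedClosure.
Context (F : fieldType) (v : valuation F) (Khat : fieldType) (vhat : valuation Khat)
  (i : {rmorphism F -> Khat}) (Kbar : closedFieldType) (vbar : valuation Kbar)
  (j : {rmorphism Khat -> Kbar}) (KK : fieldType) (w : valuation KK)
  (k : {rmorphism Kbar -> KK}).
Context (g : rat) (g0 : 0 < g)
  (vg : value_group v setT = range (fun n : int => g *~ n))
  (perf : perfect_field (residue_field v)) (iC : is_completion v vhat i)
  (jalg : is_algebraic_closure j) (jE : extends_val vhat vbar j)
  (kC : is_completion vbar w k).

Let iE : extends_val v vhat i. Proof. by case: iC. Qed.
Let idense : val_closure vhat (range i) = setT. Proof. by case: iC. Qed.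
Let kE : extends_val vbar w k. Proof. by case: kC. Qed.
Let kdense : val_closure w (range k) = setT. Proof. by case: kC. Qed.
Let wc : val_complete w. Proof. by case: kC. Qed.

Local Notation Kh := (range (k \o j)).
Local Notation Kur := (k @` max_unramified vbar (range j)).
Local Notation C := (val_closure w Kur).

Let hKh : is_subfield Kh. Proof. exact: (range_subfield (k \o j)). Qed.

Let kjE x : w (k (j x)) = vhat x. Proof. by rewrite kE jE. Qed.

Lemma Khat_discrete : discrete w g Kh.
Proof.
move=> _ [x _ <-] /=; rewrite kjE !fmorph_eq0 => x0.
have [|_ [[y _ <-] y0 <-]] := @closure_value _ vhat (range i) x _ x0.
  by rewrite idense.
rewrite iE; rewrite fmorph_eq0 in y0; have [r wr] := val_finE v y0.
have : value_group v setT r by exists y.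
by rewrite vg => -[m _ mr]; exists m; rewrite wr mr.
Qed.

Lemma Khat_uniformizer : exists2 p, Kh p & w p = g%:E.
Proof.
have : value_group v setT g by rewrite vg; exists 1.
by case=> x _ vx; exists (k (j (i x))); [exists (i x)|rewrite kjE iE].
Qed.

(** A complete subfield contains the limits of its Cauchy sequences. *)
Lemma Khat_closed : val_closed w Kh.
Proof.
move=> x cx.
have /choice[f fP] (n : nat) : exists a, (n%:R%:E <= w (x - k (j a))%R)%E.
  by have [_ [a _ <-] xa] := cx n%:R; exists a.
have [_ vc _] := iC.
have [l fl] : exists l, val_cvg vhat f l.
  apply: vc => M; have [N hN] := rat_arch M (ltr01 : 0 < 1 :> rat).
  exists N => m n Nm Nn; rewrite -kjE !rmorphB; apply: (val_dist (y := x)).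
    by rewrite val_subC; apply: le_trans (fP m); rewrite lee_fin; apply: hN.
  by apply: le_trans (fP n); rewrite lee_fin; apply: hN.
exists l => //=; apply/esym/eqP; rewrite -subr_eq0; apply/eqP.
apply: (@val_ge_all _ w) => M; have [N1 h1] := rat_arch M (ltr01 : 0 < 1 :> rat).
have [N2 h2] := fl M; pose n := maxn N1 N2.
apply: (val_dist (y := k (j (f n)))).
  by apply: le_trans (fP n); rewrite lee_fin; apply: h1; apply: leq_maxl.
by rewrite -!rmorphB kjE; apply: h2; apply: leq_maxr.
Qed.

Lemma KK_near x : x \in valring w -> exists2 y, y \in valring vbar & (0 < w (x - k y)%R)%E.
Proof.
move=> xO; have [|_ [y _ <-] xy] := @closure_gt _ w (range k) x 0 (ltry _).
  by rewrite kdense.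
by exists y => //; have := valring_congr xO xy; rewrite !valringE kE.
Qed.

(** Elements of the completion have the residues of algebraic elements. *)
Lemma Khat_residually_separable : residually_separable w Kh.
Proof.
move=> x xO; have [y yO xy] := KK_near xO.
have [H [a [b [Hm ab [hm [jh hO] hy _]]]]] :=
  residue_minpoly_separable_lift iE idense jalg jE perf yO.
set h := map_poly _ H in hm jh hO hy *.
have h'y : vbar h^`().[y] = 0%E by apply: bezout_derivative ab yO hy.
have kyO : k y \in valring w by rewrite valringE kE.
have kh : map_poly k h \is a polyOver (valring w).
  apply/polyOverP => l; rewrite coef_map valringE /= kE.
  by have /polyOverP := hO; apply.
exists (map_poly k h); split.
- by split=> // l; rewrite coef_map; have [z _ <-] := jh l; exists z.
- exists (size (map_poly k h)).-1; apply: integral_in_monic_coef.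
  by rewrite map_monic.
- rewrite -(subrK (map_poly k h).[k y] (map_poly k h).[x]); apply: val_gtD.
    exact: val_horner_congr.
  by rewrite horner_map kE.
- apply: (@val_congr0 _ w (map_poly k h)^`().[k y]).
    by rewrite deriv_map horner_map kE.
  by apply: val_horner_congr; rewrite // ?polyOver_deriv // val_subC.
Qed.

Lemma unramified_sub_max E : unramified vbar (range j) E -> E `<=` max_unramified vbar (range j).
Proof. by move=> uE x Ex B [_]; apply; exists E. Qed.

Let hmax : is_subfield (max_unramified vbar (range j)).
Proof.
apply/is_subfieldP; split=> [B [/is_subfieldP[] //]|y z|y z] Ey Ez B HB;
  have /is_subfieldP[_ hB hV] := HB.1; [apply: hB|apply: hV]; (exact: Ey || exact: Ez).
Qed.

Lemma image_subfield (A : set Kbar) : is_subfield A -> is_subfield (k @` A).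
Proof.
move=> /is_subfieldP[A1 AB AV]; apply/is_subfieldP; split.
- by exists 1; rewrite ?rmorph1.
- by move=> _ _ [x Ax <-] [y Ay <-]; exists (x - y); rewrite ?rmorphB //; apply: AB.
- by move=> _ _ [x Ax <-] [y Ay <-]; exists (x / y); rewrite ?fmorph_div //; apply: AV.
Qed.

Lemma KKur_subfield : is_subfield C.
Proof. by apply: closure_subfield; apply: image_subfield. Qed.

Lemma Khat_sub_KKur : Kh `<=` C.
Proof.
move=> _ [x _ <-]; apply: sub_closure; exists (j x) => //.
have [E [_ [uE _ _]]] := unramified_near iE idense jalg jE perf (rpred0 (valring vbar)).
by apply: (unramified_sub_max uE); have [[_ _ jEx _] _ _] := uE; apply: jEx; exists x.
Qed.

(** Residues come from the algebraic closure, where [unramified_near] lifts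
    them to unramified extensions. *)
Lemma KKur_residually_dense : residually_dense w C.
Proof.
move=> x xO; have [y yO xy] := KK_near xO.
have [E [u [uE Eu yu]]] := unramified_near iE idense jalg jE perf yO.
exists (k u); last by apply: (val_dist_gt xy); rewrite -rmorphB kE.
by apply: sub_closure; exists u => //; apply: (unramified_sub_max uE).
Qed.

(** Each unramified extension is closed, being finite-dimensional over a
    complete field, and has no new values; [unramified_sub] puts it
    inside B. *)
Lemma KKur_sub B : is_subfield B -> val_closed w B -> Kh `<=` B ->
  residually_dense w B -> C `<=` B.
Proof.
move=> hB cB KB dB; apply: (subset_trans _ cB); apply: closure_mono.
have hkB : is_subfield (k @^-1` B).
  have /is_subfieldP[B1 BB BV] := hB; apply/is_subfieldP; split=> [|x y|x y].
  - by rewrite /preimage /= rmorph1.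
  - by rewrite /preimage /= rmorphB; apply: BB.
  - by rewrite /preimage /= fmorph_div; apply: BV.
move=> _ [x mx <-]; apply: (mx (k @^-1` B)); split=> // {x mx} y [E uE Ey].
have [[hj hE jE' [n [b EE]]] ram _] := uE.
(* The image in KK is again a span, hence closed. *)
have kEE : k @` E = [set \sum_l c l * k (b l) | c in [set c | forall l : 'I_n, Kh (c l)]].
  rewrite EE; apply/seteqP; split.
    move=> _ [_ [c jc <-] <-]; exists (fun l => k (c l)).
      by move=> l /=; have [z _ <-] := jc l; exists z.
    by rewrite rmorph_sum; apply: eq_bigr => l _; rewrite rmorphM.
  move=> _ [c Kc <-]; have /choice[c' c'E] l : exists z, k (j z) = c l.
    by have [z _ <-] := Kc l; exists z.
  exists (\sum_l j (c' l) * b l).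
    by exists (fun l => j (c' l)) => // l; exists (c' l).
  by rewrite rmorph_sum; apply: eq_bigr => l _; rewrite rmorphM c'E.
have kEB : k @` E `<=` B.
  apply: (unramified_sub wc g0 hKh Khat_discrete Khat_residually_separable) => //.
  - exact: image_subfield.
  - by rewrite kEE; apply: closed_span => //; apply: Khat_closed.
  - by move=> _ [z _ <-]; exists (j z) => //; apply: jE'; exists z.
  move=> _ [z Ez <-]; rewrite fmorph_eq0 => z0.
  have [_ [c _ <-] wcz] := ramification_index1 hj hE ram Ez z0.
  by exists (k (j c)); [exists c|rewrite !kE].
by apply: kEB; exists y.
Qed.

(** This is the fact that unramified extensions do not ramify, over an
    arbitrary discrete base A: the compositum of A with the completed
    unramified closure stays inside a field with values in d Z. *)
Lemma KKur_in_discrete A d : is_subfield A -> Kh `<=` A -> discrete w d A ->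
  exists B, [/\ is_subfield B, A `<=` B, C `<=` B & discrete w d B].
Proof.
move=> hA KA dA.
have sA : residually_separable w A.
  move=> x xO; have [G [KG Gu Gx G'x]] := Khat_residually_separable xO.
  by exists G; split=> //; apply: integral_in_sub KG.
have [B [hB AB cB dB fB]] := maximal_discrete wc hA dA sA.
exists B; split=> //; apply: KKur_sub => //; exact: subset_trans AB.
Qed.

Lemma KKur_discrete : discrete w g C.
Proof.
have [B [_ _ CB dB]] := KKur_in_discrete hKh (@subset_refl _ _) Khat_discrete.
by move=> x /CB; apply: dB.
Qed.

(** The values of Khat(a) lie in (g / N) Z, hence also those of KKur(a) by
    [KKur_in_discrete]; as KKur is complete with full residue field,
    [discrete_finite] applies. *)
Lemma KKbr_algebraic a : bounded_ramification w Kh a -> algebraic_over C a.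
Proof.
move=> br; have [N N0 dN] := ramification_index_discrete g0 hKh Khat_discrete br.
have [B [hB AB CB dB]] := KKur_in_discrete (adjoin_subfield Kh a) (@adjoin_sub _ _ _) dN.
have Ba : B a by apply: AB; apply: adjoin_gen.
have hE := adjoin_subfield C a.
have EB : adjoin C a `<=` B by apply: adjoin_min.
have fin : finite_extension C (adjoin C a).
  apply: (discrete_finite wc N0 g0 KKur_subfield (@closure_closed _ _ _)) => //.
  - exact: KKur_residually_dense.
  - by have [p Kp wp] := Khat_uniformizer; exists p => //; apply: Khat_sub_KKur.
  - exact: adjoin_sub.
  - by move=> x /EB; apply: dB.
by apply: (algebraic_finite KKur_subfield fin); apply: adjoin_gen.
Qed.

(** By [algebraic_discrete] the values of KKur(a), and so those of its
    subfield Khat(a), lie in (g / N) Z for some N. *)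
Lemma algebraic_KKbr a : algebraic_over C a -> bounded_ramification w Kh a.
Proof.
move=> alg; have [N N0 dN] := algebraic_discrete KKur_subfield KKur_discrete alg.
apply: (discrete_ramification_index g0 N0 hKh Khat_uniformizer) => x Ex.
apply: dN; move: x Ex; apply: adjoin_min; first exact: adjoin_subfield.
  exact: subset_trans Khat_sub_KKur (@adjoin_sub _ _ _).
exact: adjoin_gen.
Qed.

(** The completed unramified closure already contains every residue, which
    leaves no room for a residue field extension. *)
Lemma KKur_residue_full (E : set KK) : C `<=` E ->
  @residue_subfield _ w E = @residue_subfield _ w C.
Proof.
move=> CE; apply/seteqP; split=> _ [x [Ex xO] <-]; last first.
  by exists x => //; split=> //; apply: CE.
have [c Cc xc] := KKur_residually_dense xO; have cO := valring_congr xO xc.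
by exists c => //; apply/residue_eq => //; rewrite val_subC.
Qed.

End CompletedClosure.

Theorem theorem5p8 (V : idomainType) (v : valuation {fraction V})
    (Khat : fieldType) (vhat : valuation Khat)
    (i : {rmorphism {fraction V} -> Khat})
    (Kbar : closedFieldType) (vbar : valuation Kbar)
    (j : {rmorphism Khat -> Kbar})
    (KK : fieldType) (w : valuation KK) (k : {rmorphism Kbar -> KK}) :
  is_dvr_valuation v ->
  perfect_field (residue_field v) ->
  is_completion v vhat i ->
  is_algebraic_closure j -> extends_val vhat vbar j ->
  is_completion vbar w k ->
  let KKur := val_closure w (k @` max_unramified vbar (range j)) in
  let KKbr := bounded_ramification w (range (k \o j)) in
  [/\ KKbr = [set a | algebraic_over KKur a],
      forall a, KKbr a -> totally_ramified w KKur (adjoin KKur a)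
    & is_subfield KKbr].
Proof.
move=> [_ [g g0 vg]] perf iC jalg jE kC KKur KKbr.
have brE : KKbr = [set a | algebraic_over KKur a].
  apply/seteqP; split=> a.
    exact: (KKbr_algebraic g0 vg perf iC jalg jE kC).
  exact: (algebraic_KKbr g0 vg perf iC jalg jE kC).
have hur : is_subfield KKur by apply: KKur_subfield.
split=> // [a|]; last by rewrite brE; apply: algebraic_subfield.
rewrite brE => alg; split; first exact: adjoin_finite.
by apply: (KKur_residue_full perf iC jalg jE kC); apply: adjoin_sub.
Qed.
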